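(* Let $\mathcal{A}$ be a small abelian category and let $\mathcal{C}\subseteq\mathcal{A}$ be a full additive, strictly full, Karoubi closed subcategory which is $\mathcal{A}$-approximating. (i) $\mathcal{T}^{\leq 0}_{\mathcal{C}}$ is a $t$-structure on $\mathcal{T}_{\mathcal{C}}$ with heart (denoted) $\mathcal{H}_{\mathcal{C}}$ and with truncation functor $\tau^{\leq 0}_{\mathcal{C}} = \pi_{\mathcal{C}}\circ \tau^{\leq 0}_{\mathcal{A}}|_{\mathcal{T}_{\mathcal{C}}}$. (ii) Assume that $\mathcal{A}$ has finite $\mathcal{C}$-dimension. Then $\mathcal{T}^b_{\mathcal{C}}\cap \mathcal{T}^{\leq 0}_{\mathcal{C}}$ is a $t$-structure on $\mathcal{T}^b_{\mathcal{C}}$ with heart equivalent to $\mathcal{H}_{\mathcal{C}}$.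
   Context: Strictly full means closed under isomorphisms; Karoubi closed means that direct summands in $\mathcal{A}$ of objects of $\mathcal{C}$ belong to $\mathcal{C}$. $\mathcal{T}_{\mathcal{C}}=K^-(\mathcal{C})$ is the category of bounded above cochain complexes in $\mathcal{C}$ modulo homotopy, a full triangulated subcategory of $\mathcal{T}_{\mathcal{A}}=K^-(\mathcal{A})$; $\mathcal{T}^b_{\mathcal{C}}=K^b(\mathcal{C})$ is its subcategory of bounded complexes. A $t$-structure on a triangulated category $\mathcal{T}$ is a pair of full additive subcategories $(\mathcal{T}^{\leq 0},\mathcal{T}^{\geq 0})$ with $\mathcal{T}^{\leq 0}[1]\subseteq \mathcal{T}^{\leq 0}$, $\mathrm{Hom}(\mathcal{T}^{\leq 0},\mathcal{T}^{\geq 0}[-1])=0$, and such that each $M$ fits in a triangle $M'\to M\to M''\to M'[1]$ with $M'\in\mathcal{T}^{\leq 0}$, $M''\in\mathcal{T}^{\geq 0}[-1]$. A full subcategory $\mathcal{T}^{\leq 0}$ that is closed under extensions and under $[1]$ and whose inclusion into $\mathcal{T}$ has a right adjoint $\tau^{\leq 0}$ (the truncation functor) is also called a $t$-structure; the associated $\mathcal{T}^{\geq 0}$ is $(\mathcal{T}^{\leq -1})^\perp=\{X\mid \mathrm{Hom}(\mathcal{T}^{\leq 0}[1],X)=0\}$. The heart is $\mathcal{T}^{\leq 0}\cap\mathcal{T}^{\geq 0}$. $\mathcal{T}^{\leq 0}_{\mathcal{A}}$ is the strictly full subcategory of $\mathcal{T}_{\mathcal{A}}$ generated by complexes $X$ with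 $X^i=0$ for $i>0$; it is a $t$-structure with truncation $\tau^{\leq 0}_{\mathcal{A}}X=[\cdots\to X^{-2}\to X^{-1}\to \mathrm{Ker}(X^0\to X^1)\to 0]$. $\mathcal{T}^{\leq 0}_{\mathcal{C}}:=\mathcal{T}_{\mathcal{C}}\cap\mathcal{T}^{\leq 0}_{\mathcal{A}}$ (objects isomorphic to complexes $X$ in $\mathcal{C}$ with $X^i=0$ for $i>0$). For $X\in\mathcal{T}_{\mathcal{A}}$ a $\mathcal{C}$-approximation is a quasi-isomorphism $X_{\mathcal{C}}\to X$ with $X_{\mathcal{C}}\in\mathcal{T}_{\mathcal{C}}$ inducing an isomorphism $\mathrm{Hom}_{\mathcal{T}_{\mathcal{C}}}(-,X_{\mathcal{C}})\to\mathrm{Hom}_{\mathcal{T}_{\mathcal{A}}}(-,X)|_{\mathcal{T}_{\mathcal{C}}}$. $\mathcal{C}$ is $\mathcal{A}$-approximating if every $X\in\mathcal{T}_{\mathcal{A}}$ has a $\mathcal{C}$-approximation; then $X\mapsto\pi_{\mathcal{C}}X=X_{\mathcal{C}}$ is a functor $\mathcal{T}_{\mathcal{A}}\to\mathcal{T}_{\mathcal{C}}$ right adjoint to the inclusion, chosen with $\pi_{\mathcal{C}}|_{\mathcal{T}_{\mathcal{C}}}=\mathrm{Id}$. A $\mathcal{C}$-resolution of $M\in\mathcal{A}$ is an exact sequence $\cdots\to C^{-1}\to C^0\to M\to 0$ with $C^i\in\mathcal{C}$ such that $\cdots\to\mathrm{Hom}_{\mathcal{C}}(-,C^{-1})\to\mathrm{Hom}_{\mathcal{C}}(-,C^0)\to\mathrm{Hom}_{\mathcal{A}}(-,M)|_{\mathcal{C}}\to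 0$ is exact. The $\mathcal{C}$-dimension of $M$ is the smallest $n\in\mathbb{N}\cup\{\infty\}$ such that $M$ has a $\mathcal{C}$-resolution $0\to C^{-n}\to\cdots\to C^0\to M\to 0$; the $\mathcal{C}$-dimension of $\mathcal{A}$ is the supremum over all objects. *)

(* Defs.v *)
From HB Require Import structures.
From mathcomp Require Import all_boot all_order all_algebra.
From mathcomp Require Import boolp.

Set Implicit Arguments.
Unset Strict Implicit.
Unset Printing Implicit Defensive.

Import Order.TTheory GRing.Theory Num.Theory.
Local Open Scope ring_scope.
Local Open Scope quotient_scope.

Reserved Notation "g \oc f" (at level 40, left associativity).

Record preadd := Preadd {
  ob :> Type;
  hom : ob -> ob -> zmodType;
  idm : forall X, hom X X;
  comp : forall X Y Z, hom Y Z -> hom X Y -> hom X Z;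
  compA : forall X Y Z W (h : hom Z W) (g : hom Y Z) (f : hom X Y),
    comp h (comp g f) = comp (comp h g) f;
  comp1m : forall X Y (f : hom X Y), comp (idm Y) f = f;
  compm1 : forall X Y (f : hom X Y), comp f (idm X) = f;
  compDl : forall X Y Z (g g' : hom Y Z) (f : hom X Y),
    comp (g + g') f = comp g f + comp g' f;
  compDr : forall X Y Z (g : hom Y Z) (f f' : hom X Y),
    comp g (f + f') = comp g f + comp g f' }.

Arguments hom {p} X Y.
Arguments idm {p} X.
Arguments comp {p X Y Z} g f.
Notation "g \oc f" := (comp g f).

Section Preadditive.
Variable T : preadd.
Implicit Types X Y Z W : T.

Lemma comp0m X Y Z (f : hom X Y) : (0 : hom Y Z) \oc f = 0.
Proof. by apply: (@addrI _ (0 \oc f)); rewrite -compDl !addr0. Qed.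

Lemma compm0 X Y Z (g : hom Y Z) : g \oc (0 : hom X Y) = 0.
Proof. by apply: (@addrI _ (g \oc 0)); rewrite -compDr !addr0. Qed.

Lemma compNm X Y Z (g : hom Y Z) (f : hom X Y) : (- g) \oc f = - (g \oc f).
Proof. by apply: (@addrI _ (g \oc f)); rewrite -compDl !subrr comp0m. Qed.

Lemma compmN X Y Z (g : hom Y Z) (f : hom X Y) : g \oc (- f) = - (g \oc f).
Proof. by apply: (@addrI _ (g \oc f)); rewrite -compDr !subrr compm0. Qed.

Definition is_iso X Y (f : hom X Y) :=
  exists g : hom Y X, g \oc f = idm X /\ f \oc g = idm Y.

Definition isomorphic X Y := exists f : hom X Y, is_iso f.

Definition is_zero X :=
  (forall Y (f g : hom X Y), f = g) /\ (forall Y (f g : hom Y X), f = g).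

Definition is_biprod X Y S (i1 : hom X S) (i2 : hom Y S)
    (p1 : hom S X) (p2 : hom S Y) :=
  [/\ p1 \oc i1 = idm X, p2 \oc i2 = idm Y, p1 \oc i2 = 0, p2 \oc i1 = 0
    & i1 \oc p1 + i2 \oc p2 = idm S].

Definition direct_sum X Y S := exists i1 i2 p1 p2, @is_biprod X Y S i1 i2 p1 p2.

Definition is_additive :=
  (exists Z, is_zero Z) /\ (forall X Y, exists S, direct_sum X Y S).

Definition is_kernel X Y (f : hom X Y) K (k : hom K X) :=
  f \oc k = 0 /\
  forall W (g : hom W X), f \oc g = 0 -> exists! h : hom W K, k \oc h = g.

Definition is_cokernel X Y (f : hom X Y) Q (q : hom Y Q) :=
  q \oc f = 0 /\
  forall W (g : hom Y W), g \oc f = 0 -> exists! h : hom Q W, h \oc q = g.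

Definition is_mono X Y (f : hom X Y) :=
  forall W (g h : hom W X), f \oc g = f \oc h -> g = h.

Definition is_epi X Y (f : hom X Y) :=
  forall W (g h : hom Y W), g \oc f = h \oc f -> g = h.

Definition is_abelian :=
  [/\ is_additive,
      forall X Y (f : hom X Y), exists K (k : hom K X), is_kernel f k,
      forall X Y (f : hom X Y), exists Q (q : hom Y Q), is_cokernel f q,
      forall X Y (f : hom X Y), is_mono f ->
        exists Z (g : hom Y Z), is_kernel g f
    & forall X Y (f : hom X Y), is_epi f ->
        exists Z (g : hom Z X), is_cokernel g f].

Definition strictly_full (P : T -> Prop) :=
  forall X Y, isomorphic X Y -> P X -> P Y.

Definition karoubi_closed (P : T -> Prop) :=
  forall X Y S, direct_sum X Y S -> P S -> P X.

Definition fullsub (P : T -> Prop) : preadd :=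
  let S := {X : T | P X} in
  @Preadd S (fun X Y : S => hom (sval X) (sval Y))
    (fun X : S => idm (sval X)) (fun (X Y Z : S) g f => g \oc f)
    (fun X Y Z W : S => @compA T _ _ _ _) (fun X Y : S => @comp1m T _ _)
    (fun X Y : S => @compm1 T _ _) (fun X Y Z : S => @compDl T _ _ _)
    (fun X Y Z : S => @compDr T _ _ _).

End Preadditive.

Record functor (S T : preadd) := Functor {
  fob :> S -> T;
  fmap : forall X Y : S, hom X Y -> hom (fob X) (fob Y);
  fmap_id : forall X : S, fmap (idm X) = idm (fob X);
  fmap_comp : forall (X Y Z : S) (g : hom Y Z) (f : hom X Y),
    fmap (g \oc f) = fmap g \oc fmap f }.
Arguments fmap {S T} F {X Y} f : rename.

Section Functors.
Variables S T U : preadd.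

Definition idF : functor T T :=
  @Functor T T id (fun X Y f => f) (fun=> erefl) (fun X Y Z g f => erefl).

Lemma compF_id (G : functor T U) (F : functor S T) (X : S) :
  fmap G (fmap F (idm X)) = idm (G (F X)).
Proof. by rewrite !fmap_id. Qed.

Lemma compF_comp (G : functor T U) (F : functor S T) (X Y Z : S)
    (g : hom Y Z) (f : hom X Y) :
  fmap G (fmap F (g \oc f)) = fmap G (fmap F g) \oc fmap G (fmap F f).
Proof. by rewrite !fmap_comp. Qed.

Definition compF (G : functor T U) (F : functor S T) : functor S U :=
  @Functor S U (fun X => G (F X)) (fun X Y f => fmap G (fmap F f))
    (compF_id G F) (compF_comp G F).

Definition incl (P : T -> Prop) : functor (fullsub P) T :=
  @Functor (fullsub P) T (fun X => sval X) (fun X Y f => f)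
    (fun=> erefl) (fun X Y Z g f => erefl).

Definition corestr (P : T -> Prop) (F : functor S T) (FP : forall X, P (F X)) :
    functor S (fullsub P) :=
  @Functor S (fullsub P) (fun X => exist P (F X) (FP X))
    (fun X Y f => fmap F f) (fmap_id F) (@fmap_comp _ _ F).

Definition nat_iso (F G : functor S T) :=
  exists eta : forall X : S, hom (F X) (G X),
    (forall X, is_iso (eta X)) /\
    (forall X Y (f : hom X Y), eta Y \oc fmap F f = fmap G f \oc eta X).

(** [G] is right adjoint to [F] *)
Definition right_adjoint (F : functor S T) (G : functor T S) :=
  exists phi : forall (X : S) (Y : T), hom (F X) Y -> hom X (G Y),
    [/\ forall X Y, bijective (phi X Y),
        forall X' X Y (a : hom X' X) (f : hom (F X) Y),
          phi X' Y (f \oc fmap F a) = phi X Y f \oc a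
      & forall X Y Y' (b : hom Y Y') (f : hom (F X) Y),
          phi X Y' (b \oc f) = fmap G b \oc phi X Y f].

End Functors.
Arguments idF {T}.
Arguments incl {T} P.

Definition equivalent (S T : preadd) :=
  exists (F : functor S T) (G : functor T S),
    nat_iso (compF G F) idF /\ nat_iso (compF F G) idF.

(** The part of the structure of a triangulated category which enters the
    notion of a t-structure: the shift [X |-> X[1]] and the distinguished
    triangles [X -> Y -> Z -> X[1]]. *)
Record tricat := Tricat {
  tcat :> preadd;
  shift : functor tcat tcat;
  dist : forall X Y Z : tcat,
    hom X Y -> hom Y Z -> hom Z (shift X) -> Prop }.
Arguments shift {t}.
Arguments dist {t X Y Z} f g h.

Section TStructures.
Variable T : tricat.
Implicit Type P : T -> Prop.

Definition sub_shift P (PS : forall X, P X -> P (shift X)) :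
    functor (fullsub P) (fullsub P) :=
  @Functor (fullsub P) (fullsub P)
    (fun X => exist P (shift (sval X)) (PS _ (svalP X)))
    (fun X Y f => fmap shift f)
    (fun X => fmap_id shift (sval X)) (fun X Y Z g f => fmap_comp shift g f).

Definition subtri P (PS : forall X, P X -> P (shift X)) : tricat :=
  @Tricat (fullsub P) (sub_shift PS) (fun X Y Z f g h => @dist T _ _ _ f g h).

Definition t_structure P :=
  [/\ forall X, P X -> P (shift X),
      forall X Y Z (f : hom X Y) (g : hom Y Z) (h : hom Z (shift X)),
        dist f g h -> P X -> P Z -> P Y
    & exists tau : functor T (fullsub P), right_adjoint (incl P) tau].

(** The truncation functor is viewed as an endofunctor of [T]. *)
Definition is_truncation P (F : functor T T) :=
  exists FP : forall X, P (F X), right_adjoint (incl P) (corestr FP).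

(** the associated T^{>=0} *)
Definition coaisle P (X : T) := forall Y, P Y -> forall f : hom (shift Y) X, f = 0.

Definition heart P : preadd := fullsub (fun X : T => P X /\ coaisle P X).

End TStructures.

(** The differential is indexed by pairs of degrees, and vanishes outside
    [i -> i + 1]; this avoids all transports between degrees. *)
Record complex (A : preadd) := Complex {
  cob :> int -> A;
  d : forall i j, hom (cob i) (cob j);
  d_shape : forall i j, j != i + 1 -> d i j = 0;
  dd : forall i j k, d j k \oc d i j = 0 }.
Arguments d {A} c i j.

Record chmap (A : preadd) (X Y : complex A) := Chmap {
  cm :> forall i, hom (X i) (Y i);
  cmd : forall i j, cm j \oc d X i j = d Y i j \oc cm i }.

Section ChainMaps.
Variable A : preadd.
Implicit Types X Y Z : complex A.

Lemma chmap_eq X Y (f g : chmap X Y) : (forall i, f i = g i) -> f = g.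
Proof.
case: f g => [f Hf] [g Hg] /= fg.
have E : f = g by apply: functional_extensionality_dep.
by case: g / E Hg {fg} => Hg; congr Chmap; apply: Prop_irrelevance.
Qed.

Lemma chmap0_proof X Y i j :
  (0 : hom (X j) (Y j)) \oc d X i j = d Y i j \oc (0 : hom (X i) (Y i)).
Proof. by rewrite comp0m compm0. Qed.
Definition chmap0 X Y := Chmap (@chmap0_proof X Y).

Lemma chmapN_proof X Y (f : chmap X Y) i j :
  (- f j) \oc d X i j = d Y i j \oc (- f i).
Proof. by rewrite compNm compmN cmd. Qed.
Definition chmapN X Y (f : chmap X Y) := Chmap (chmapN_proof f).

Lemma chmapD_proof X Y (f g : chmap X Y) i j :
  (f j + g j) \oc d X i j = d Y i j \oc (f i + g i).
Proof. by rewrite compDl compDr !cmd. Qed.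
Definition chmapD X Y (f g : chmap X Y) := Chmap (chmapD_proof f g).

HB.instance Definition _ X Y := gen_eqMixin (chmap X Y).
HB.instance Definition _ X Y := gen_choiceMixin (chmap X Y).

Lemma chmapDA X Y : associative (@chmapD X Y).
Proof. by move=> f g h; apply: chmap_eq => i /=; rewrite addrA. Qed.
Lemma chmapDC X Y : commutative (@chmapD X Y).
Proof. by move=> f g; apply: chmap_eq => i /=; rewrite addrC. Qed.
Lemma chmapD0 X Y : left_id (chmap0 X Y) (@chmapD X Y).
Proof. by move=> f; apply: chmap_eq => i /=; rewrite add0r. Qed.
Lemma chmapDN X Y : left_inverse (chmap0 X Y) (@chmapN X Y) (@chmapD X Y).
Proof. by move=> f; apply: chmap_eq => i /=; rewrite addNr. Qed.

HB.instance Definition _ X Y := GRing.isZmodule.Build (chmap X Y)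
  (@chmapDA X Y) (@chmapDC X Y) (@chmapD0 X Y) (@chmapDN X Y).

Lemma chcomp_proof X Y Z (g : chmap Y Z) (f : chmap X Y) i j :
  (g j \oc f j) \oc d X i j = d Z i j \oc (g i \oc f i).
Proof. by rewrite -compA cmd compA cmd compA. Qed.
Definition chcomp X Y Z (g : chmap Y Z) (f : chmap X Y) : chmap X Z :=
  Chmap (chcomp_proof g f).

Lemma chid_proof X i j : idm (X j) \oc d X i j = d X i j \oc idm (X i).
Proof. by rewrite comp1m compm1. Qed.
Definition chid X : chmap X X := Chmap (@chid_proof X).

(** Only the components [h i j] with [i = j + 1] are used. *)
Definition nullhtpy X Y (f : chmap X Y) :=
  exists h : forall i j, hom (X i) (Y j),
    forall i, f i = d Y (i - 1) i \oc h i (i - 1) + h (i + 1) i \oc d X i (i + 1).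

Definition null X Y : {pred chmap X Y} := fun f => `[< nullhtpy f >].

Lemma null_closed X Y : zmod_closed (@null X Y).
Proof.
split; first by apply/asboolP; exists (fun _ _ => 0) => i;
  rewrite compm0 comp0m addr0.
move=> f g /asboolP[h Hh] /asboolP[k Hk]; apply/asboolP.
exists (fun i j => h i j - k i j) => i /=.
by rewrite Hh Hk !compDl !compDr !compNm !compmN opprD addrACA.
Qed.
HB.instance Definition _ X Y :=
  GRing.isZmodClosed.Build _ (@null X Y) (@null_closed X Y).

Definition khom X Y : zmodType := @Quotient.quot (chmap X Y) (@null X Y).

Definition cls X Y (f : chmap X Y) : khom X Y := \pi f.

Lemma clsP X Y (f : khom X Y) : exists u, cls u = f.
Proof. by exists (repr f); rewrite /cls reprK. Qed.

Lemma cls_eqP X Y (f g : chmap X Y) : cls f = cls g <-> nullhtpy (f - g).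
Proof.
have H : (f - g \in @null X Y) = (cls f == cls g) by rewrite Quotient.idealrBE.
split=> [E|N]; first by apply/asboolP; move: H; rewrite E eqxx.
by apply/eqP; rewrite -H; apply/asboolP.
Qed.

Lemma clsD X Y (f g : chmap X Y) : cls (f + g) = cls f + cls g.
Proof. by rewrite /cls piE. Qed.

Lemma null_compl X Y Z (g : chmap Y Z) (f : chmap X Y) :
  nullhtpy f -> nullhtpy (chcomp g f).
Proof.
case=> h Hh; exists (fun i j => g j \oc h i j) => i /=.
by rewrite Hh compDr !compA cmd.
Qed.

Lemma null_compr X Y Z (g : chmap Y Z) (f : chmap X Y) :
  nullhtpy g -> nullhtpy (chcomp g f).
Proof.
case=> h Hh; exists (fun i j => h i j \oc f i) => i /=.
by rewrite Hh compDl -!compA -cmd.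
Qed.

Definition kcomp X Y Z (g : khom Y Z) (f : khom X Y) : khom X Z :=
  cls (chcomp (repr g) (repr f)).

Lemma kcompE X Y Z (g : chmap Y Z) (f : chmap X Y) :
  kcomp (cls g) (cls f) = cls (chcomp g f).
Proof.
have rK W V (u : chmap W V) : nullhtpy (repr (cls u) - u).
  by apply/cls_eqP; rewrite /cls reprK.
apply/cls_eqP.
have -> : chcomp (repr (cls g)) (repr (cls f)) - chcomp g f =
  chcomp (repr (cls g) - g) (repr (cls f)) + chcomp g (repr (cls f) - f).
  by apply: chmap_eq => i /=; rewrite compDl compDr compNm compmN addrA addrNK.
have [h Hh] := null_compr (repr (cls f)) (rK _ _ g).
have [k Hk] := null_compl g (rK _ _ f).
exists (fun i j => h i j + k i j) => i.
rewrite !compDl !compDr addrACA.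
by move: (Hh i) (Hk i) => /= <- <-.
Qed.

Lemma kcompA X Y Z W (h : khom Z W) (g : khom Y Z) (f : khom X Y) :
  kcomp h (kcomp g f) = kcomp (kcomp h g) f.
Proof.
have [[{}h <-] [{}g <-] [{}f <-]] := And3 (clsP h) (clsP g) (clsP f).
by rewrite !kcompE; congr cls; apply: chmap_eq => i /=; rewrite compA.
Qed.

Lemma kcomp1m X Y (f : khom X Y) : kcomp (cls (chid Y)) f = f.
Proof.
have [{}f <-] := clsP f.
by rewrite !kcompE; congr cls; apply: chmap_eq => i /=; rewrite comp1m.
Qed.

Lemma kcompm1 X Y (f : khom X Y) : kcomp f (cls (chid X)) = f.
Proof.
have [{}f <-] := clsP f.
by rewrite !kcompE; congr cls; apply: chmap_eq => i /=; rewrite compm1.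
Qed.

Lemma kcompDl X Y Z (g g' : khom Y Z) (f : khom X Y) :
  kcomp (g + g') f = kcomp g f + kcomp g' f.
Proof.
have [[{}g <-] [{}g' <-] [{}f <-]] := And3 (clsP g) (clsP g') (clsP f).
rewrite -clsD !kcompE -clsD; congr cls.
by apply: chmap_eq => i /=; rewrite compDl.
Qed.

Lemma kcompDr X Y Z (g : khom Y Z) (f f' : khom X Y) :
  kcomp g (f + f') = kcomp g f + kcomp g f'.
Proof.
have [[{}g <-] [{}f <-] [{}f' <-]] := And3 (clsP g) (clsP f) (clsP f').
rewrite -clsD !kcompE -clsD; congr cls.
by apply: chmap_eq => i /=; rewrite compDr.
Qed.

Definition Kcat : preadd := @Preadd (complex A) khom (fun X => cls (chid X)) kcomp
  kcompA kcomp1m kcompm1 kcompDl kcompDr.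

Lemma shiftc_shape X i j : j != i + 1 -> - d X (i + 1) (j + 1) = 0.
Proof. by move=> ij; rewrite d_shape ?oppr0 // (inj_eq (addIr _)). Qed.
Lemma shiftc_dd X i j k :
  (- d X (j + 1) (k + 1)) \oc (- d X (i + 1) (j + 1)) = 0.
Proof. by rewrite compNm compmN dd !oppr0. Qed.
Definition shiftc X : complex A := Complex (@shiftc_shape X) (@shiftc_dd X).

Lemma shiftm_proof X Y (f : chmap X Y) i j :
  f (j + 1) \oc d (shiftc X) i j = d (shiftc Y) i j \oc f (i + 1).
Proof. by rewrite /= compNm compmN cmd. Qed.
Definition shiftm X Y (f : chmap X Y) : chmap (shiftc X) (shiftc Y) :=
  @Chmap _ (shiftc X) (shiftc Y) (fun i => f (i + 1)) (shiftm_proof f).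

Lemma shiftm_null X Y (f : chmap X Y) : nullhtpy f -> nullhtpy (shiftm f).
Proof.
case=> h Hh; exists (fun i j => - h (i + 1) (j + 1)) => i /=.
rewrite !compNm !compmN !opprK Hh.
by rewrite (_ : i - 1 + 1 = i + 1 - 1) // addrAC.
Qed.

Definition kshift_map X Y (f : khom X Y) : khom (shiftc X) (shiftc Y) :=
  cls (shiftm (repr f)).

Lemma kshift_mapE X Y (f : chmap X Y) : kshift_map (cls f) = cls (shiftm f).
Proof.
apply/cls_eqP.
have -> : shiftm (repr (cls f)) - shiftm f = shiftm (repr (cls f) - f).
  exact: chmap_eq.
by apply/shiftm_null/cls_eqP; rewrite /cls reprK.
Qed.

Lemma kshift_id (X : Kcat) : kshift_map (idm X) = idm (shiftc X : Kcat).
Proof. by rewrite /= kshift_mapE; congr cls; apply: chmap_eq. Qed.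

Lemma kshift_comp (X Y Z : Kcat) (g : hom Y Z) (f : hom X Y) :
  kshift_map (g \oc f) = kcomp (kshift_map g) (kshift_map f).
Proof.
have [[{}g <-] [{}f <-]] := conj (clsP g) (clsP f).
by rewrite /= kcompE !kshift_mapE kcompE; congr cls; apply: chmap_eq.
Qed.

Definition kshift : functor Kcat Kcat :=
  @Functor Kcat Kcat shiftc kshift_map kshift_id kshift_comp.

(** [X -u-> Y -v-> Z -w-> X[1]] is the triangle of the mapping cone of [u]:
    [Z^i] is the direct sum of [X^(i+1)] and [Y^i], with differential
    [(x, y) |-> (- dx, ux + dy)], and [v], [w] are the canonical injection and
    projection. The component [- dx] is accounted for by [w] being a chain map
    to [X[1]], and the restriction of the differential to [Y] by [v] being a
    chain map. *)
Definition cone_triangle X Y Z (u : chmap X Y) (v : chmap Y Z)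
    (w : chmap Z (shiftc X)) :=
  exists (s : forall i, hom (X (i + 1)) (Z i)) (r : forall i, hom (Z i) (Y i)),
    (forall i, is_biprod (s i) (v i) (w i) (r i)) /\
    (forall i, r (i + 1) \oc d Z i (i + 1) =
       u (i + 1) \oc w i + d Y i (i + 1) \oc r i).

Definition kdist (X Y Z : Kcat) (f : hom X Y) (g : hom Y Z)
    (h : hom Z (kshift X)) :=
  exists (X' Y' Z' : complex A) (u : chmap X' Y') (v : chmap Y' Z')
    (w : chmap Z' (shiftc X')) (a : @hom Kcat X X') (b : @hom Kcat Y Y')
    (c : @hom Kcat Z Z'),
    [/\ cone_triangle u v w, [/\ is_iso a, is_iso b & is_iso c],
        b \oc f = (cls u : @hom Kcat X' Y') \oc a,
        c \oc g = (cls v : @hom Kcat Y' Z') \oc b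
      & fmap kshift a \oc h = (cls w : @hom Kcat Z' (kshift X')) \oc c].

Definition K : tricat := @Tricat Kcat kshift kdist.

Definition bounded_above (X : complex A) :=
  exists n : int, forall i, n < i -> is_zero (X i).

Definition bounded_below (X : complex A) :=
  exists n : int, forall i, i < n -> is_zero (X i).

Lemma bounded_above_shift (X : K) : bounded_above X -> bounded_above (shift X).
Proof.
by case=> n Hn; exists n => i ni; apply: Hn; apply: (lt_trans ni); rewrite ltrDl.
Qed.

Lemma bounded_below_shift (X : K) : bounded_below X -> bounded_below (shift X).
Proof.
by case=> n Hn; exists (n - 1) => i; rewrite ltrBrDr; apply: Hn.
Qed.

(** K^-(A) *)
Definition TA : tricat := subtri bounded_above_shift.

End ChainMaps.

Record abcat := Abcat { acat :> preadd; abelianP : is_abelian acat }.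

Section Abelian.
Variable A : abcat.

Lemma zob_ex : exists Z : A, is_zero Z.
Proof. by case: (abelianP A) => -[]. Qed.
Definition zob : A := sval (cid zob_ex).
Lemma zobP : is_zero zob. Proof. exact: (svalP (cid zob_ex)). Qed.

Section KerCoker.
Variables (X Y : A) (f : hom X Y).

Lemma ker_ex : exists K (k : hom K X), is_kernel f k.
Proof. by case: (abelianP A). Qed.
Definition kerob : A := sval (cid ker_ex).
Definition kermor : hom kerob X := sval (cid (svalP (cid ker_ex))).
Lemma kermorP : is_kernel f kermor.
Proof. exact: (svalP (cid (svalP (cid ker_ex)))). Qed.

Definition ker_lift W (g : hom W X) (fg : f \oc g = 0) : hom W kerob :=
  sval (cid (proj2 kermorP W g fg)).
Lemma ker_liftK W (g : hom W X) (fg : f \oc g = 0) :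
  kermor \oc ker_lift fg = g.
Proof. by rewrite /ker_lift; case: cid => h []. Qed.
Lemma kermor_mono : is_mono kermor.
Proof.
move=> W g h gh; have [k0 Hk] := kermorP.
have f0 : f \oc (kermor \oc h) = 0 by rewrite compA k0 comp0m.
by have [e [_ He]] := Hk _ _ f0; rewrite -(He g gh) (He h erefl).
Qed.

Lemma coker_ex : exists Q (q : hom Y Q), is_cokernel f q.
Proof. by case: (abelianP A). Qed.
Definition cokerob : A := sval (cid coker_ex).
Definition cokermor : hom Y cokerob := sval (cid (svalP (cid coker_ex))).
Lemma cokermorP : is_cokernel f cokermor.
Proof. exact: (svalP (cid (svalP (cid coker_ex)))). Qed.

Definition coker_desc W (g : hom Y W) (gf : g \oc f = 0) : hom cokerob W :=
  sval (cid (proj2 cokermorP W g gf)).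
Lemma coker_descK W (g : hom Y W) (gf : g \oc f = 0) :
  coker_desc gf \oc cokermor = g.
Proof. by rewrite /coker_desc; case: cid => h []. Qed.

End KerCoker.

(** [Im f = Ker g], where the image of [f] is the kernel of its cokernel *)
Definition exact_at (X Y Z : A) (f : hom X Y) (g : hom Y Z) :=
  is_kernel g (kermor (cokermor f)).

Definition cocyc (X : complex A) i : A := kerob (d X i (i + 1)).

Definition bd (X : complex A) i : hom (X (i - 1)) (cocyc X i) :=
  ker_lift (dd X (i - 1) i (i + 1)).

Definition coh (X : complex A) i : A := cokerob (bd X i).

Section CohMap.
Variables (X Y : complex A) (f : chmap X Y) (i : int).

Lemma cocyc_map_proof :
  d Y i (i + 1) \oc (f i \oc kermor (d X i (i + 1))) = 0.
Proof. by rewrite compA -cmd -compA (proj1 (kermorP _)) compm0. Qed.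
Definition cocyc_map : hom (cocyc X i) (cocyc Y i) := ker_lift cocyc_map_proof.

Lemma coh_map_proof : (cokermor (bd Y i) \oc cocyc_map) \oc bd X i = 0.
Proof.
have E : cocyc_map \oc bd X i = bd Y i \oc f (i - 1).
  apply: kermor_mono; rewrite compA ker_liftK -compA ker_liftK.
  by rewrite compA ker_liftK cmd.
by rewrite -compA E compA (proj1 (cokermorP _)) comp0m.
Qed.
Definition coh_map : hom (coh X i) (coh Y i) := coker_desc coh_map_proof.

End CohMap.

Definition quasi_iso (X Y : K A) (f : hom X Y) :=
  exists2 u : chmap X Y, cls u = f & forall i, is_iso (coh_map u i).

(** [tau X] is [... -> X^-2 -> X^-1 -> Ker (X^0 -> X^1) -> 0]. *)

Section Truncation.
Variable X : complex A.

Definition tau_ob (i : int) : A :=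
  match i with
  | Negz n => X (Negz n)
  | Posz 0 => kerob (d X 0 1)
  | Posz _.+1 => zob
  end.

Definition tau_d (i j : int) : hom (tau_ob i) (tau_ob j) :=
  match i, j return hom (tau_ob i) (tau_ob j) with
  | Negz m, Negz n => d X (Negz m) (Negz n)
  | Negz m, Posz 0 => ker_lift (dd X (Negz m) 0 1)
  | _, _ => 0
  end.

Lemma tau_shape i j : j != i + 1 -> tau_d i j = 0.
Proof.
case: i j => [i|i] [[|j]|j] //= ij; last by rewrite d_shape.
by apply: kermor_mono; rewrite ker_liftK compm0 d_shape.
Qed.

Lemma tau_dd i j k : tau_d j k \oc tau_d i j = 0.
Proof.
case: i j k => [i|i] [[|j]|j] [[|k]|k] //=; rewrite ?comp0m ?compm0 ?dd //.
by apply: kermor_mono; rewrite compA ker_liftK dd compm0.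
Qed.

Definition tau : complex A := Complex tau_shape tau_dd.

End Truncation.

Lemma tau_bounded (X : K A) : bounded_above (tau X : K A).
Proof. by exists 0 => -[[|i]|i] //= _; apply: zobP. Qed.

Lemma tau_ker_proof (X Y : complex A) (f : chmap X Y) :
  d Y 0 1 \oc (f 0 \oc kermor (d X 0 1)) = 0.
Proof. by rewrite compA -cmd -compA (proj1 (kermorP _)) compm0. Qed.

Definition tau_map (X Y : complex A) (f : chmap X Y) (i : int) :
    hom (tau X i) (tau Y i) :=
  match i return hom (tau X i) (tau Y i) with
  | Negz n => f (Negz n)
  | Posz 0 => ker_lift (tau_ker_proof f)
  | Posz _.+1 => 0
  end.

Lemma tau_map_proof (X Y : complex A) (f : chmap X Y) i j :
  tau_map f j \oc d (tau X) i j = d (tau Y) i j \oc tau_map f i.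
Proof.
case: i j => [[|i]|i] [[|j]|j] //=; rewrite ?comp0m ?compm0 ?cmd //.
by apply: kermor_mono; rewrite !compA !ker_liftK -compA ker_liftK cmd.
Qed.
Definition taum (X Y : complex A) (f : chmap X Y) : chmap (tau X) (tau Y) :=
  Chmap (tau_map_proof f).

Lemma taumB (X Y : complex A) (f g : chmap X Y) : taum f - taum g = taum (f - g).
Proof.
apply: chmap_eq => -[[|i]|i] //=; last by rewrite subr0.
by apply: kermor_mono; rewrite compDr compmN !ker_liftK compDl compNm.
Qed.

Lemma taum_null (X Y : complex A) (f : chmap X Y) :
  nullhtpy f -> nullhtpy (taum f).
Proof.
case=> h Hh.
pose h' i j : hom (tau X i) (tau Y j) :=
  match i, j return hom (tau X i) (tau Y j) with
  | Negz m, Negz n => h (Negz m) (Negz n)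
  | Posz 0, Negz n => h 0 (Negz n) \oc kermor (d X 0 1)
  | _, _ => 0
  end.
exists h' => -[[|i]|i].
- rewrite (_ : Posz 0 - 1 = Negz 0) // (_ : Posz 0 + 1 = Posz 1) //=.
  rewrite comp0m addr0; apply: kermor_mono; rewrite ker_liftK compA ker_liftK.
  rewrite Hh (_ : 0 - 1 = Negz 0) // (_ : 0 + 1 = 1) // compDl.
  by rewrite -[h 1 0 \oc _ \oc _]compA (proj1 (kermorP _)) compm0 addr0 compA.
- exact: (proj2 zobP).
- rewrite (_ : Negz i - 1 = Negz i.+1); last first.
    by rewrite !NegzE -opprD -PoszD addn1.
  case: i => [|i].
    rewrite (_ : Negz 0 + 1 = Posz 0) //= -compA ker_liftK.
    by rewrite Hh (_ : Negz 0 - 1 = Negz 1) // (_ : Negz 0 + 1 = 0).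
  have E : Negz i.+1 + 1 = Negz i.
    by rewrite !NegzE -[in LHS]addn1 PoszD opprD addrNK.
  have E' : Negz i.+1 - 1 = Negz i.+2.
    by rewrite !NegzE -opprD -PoszD addn1.
  by rewrite E /= Hh E E'.
Qed.

Definition ktau_map (X Y : K A) (f : hom X Y) : @hom (K A) (tau X) (tau Y) :=
  cls (taum (repr f)).

Lemma ktau_mapE (X Y : complex A) (f : chmap X Y) :
  @ktau_map X Y (cls f) = cls (taum f).
Proof.
apply/cls_eqP; rewrite taumB.
by apply/taum_null/cls_eqP; rewrite /cls reprK.
Qed.

Lemma ktau_id (X : K A) : ktau_map (idm X) = idm (tau X : K A).
Proof.
rewrite ktau_mapE; congr cls; apply: chmap_eq => -[[|i]|i] //=.
  by apply: kermor_mono; rewrite ker_liftK comp1m compm1.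
exact: (proj2 zobP).
Qed.

Lemma ktau_comp (X Y Z : K A) (g : hom Y Z) (f : hom X Y) :
  ktau_map (g \oc f) = ktau_map g \oc ktau_map f.
Proof.
have [[{}g <-] [{}f <-]] := conj (clsP g) (clsP f).
rewrite /= kcompE !ktau_mapE kcompE; congr cls.
apply: chmap_eq => -[[|i]|i] //=; last by rewrite comp0m.
apply: kermor_mono; rewrite ker_liftK [RHS]compA ker_liftK.
by rewrite -[RHS]compA ker_liftK compA.
Qed.

Definition tauA : functor (TA A) (TA A) :=
  @Functor (TA A) (TA A)
    (fun X => exist _ (tau (sval X) : K A) (tau_bounded (sval X)))
    (fun X Y f => ktau_map f) (fun X => ktau_id (sval X))
    (fun X Y Z g f => ktau_comp g f).

Definition TleA (X : TA A) :=
  exists2 Y : TA A, isomorphic X Y & forall i : int, 0 < i -> is_zero (sval Y i).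

Section Subcategory.
Variable C : A -> Prop.

(** K^-(C) is the full subcategory of K^-(A) of the complexes with terms in [C]
    and K^b(C) the full subcategory of the bounded ones. *)
Definition terms_in (X : TA A) := forall i, C (sval X i).

Lemma terms_in_shift X : terms_in X -> terms_in (shift X).
Proof. by move=> CX i; apply: CX. Qed.

Definition TC : tricat := subtri terms_in_shift.

Definition bounded (X : TC) :=
  bounded_above (sval (sval X)) /\ bounded_below (sval (sval X)).

Lemma bounded_shift X : bounded X -> bounded (shift X).
Proof. by case=> /bounded_above_shift a /bounded_below_shift b. Qed.

Definition TbC : tricat := subtri bounded_shift.

Definition inclCA : functor TC (TA A) := incl terms_in.
Definition inclbC : functor TbC TC := incl bounded.

Definition TleC (X : TC) := TleA (inclCA X).
Definition TbleC (X : TbC) := TleC (inclbC X).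

Definition capprox (X : TA A) (XC : TC) (e : hom (inclCA XC) X) :=
  quasi_iso e /\
  forall Y : TC, bijective (fun g : hom Y XC => e \oc fmap inclCA g).

Definition approximating :=
  forall X : TA A, exists (XC : TC) (e : hom (inclCA XC) X), capprox e.

(** On T_C, [pi_C] is normalised to be the identity, see [piC_incl]. *)
Section Projection.
Hypothesis approxC : approximating.

Definition approx_data (X : TA A) : {XC : TC & hom (inclCA XC) X} :=
  match pselect (terms_in X) with
  | left CX => existT (fun XC : TC => hom (inclCA XC) X)
                 (exist terms_in X CX) (idm X)
  | right _ => existT (fun XC : TC => hom (inclCA XC) X)
                 (sval (cid (approxC X))) (sval (cid (svalP (cid (approxC X)))))
  end.

Definition pi_ob (X : TA A) : TC := projT1 (approx_data X).
Definition pi_eps (X : TA A) : hom (inclCA (pi_ob X)) X := projT2 (approx_data X).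

Lemma pi_eps_bij (X : TA A) (Y : TC) :
  bijective (fun g : hom Y (pi_ob X) => pi_eps X \oc fmap inclCA g).
Proof.
rewrite /pi_eps /pi_ob /approx_data; case: pselect => [CX|_] /=.
  by exists id => g; exact: kcomp1m.
exact: (proj2 (svalP (cid (svalP (cid (approxC X)))))).
Qed.

Lemma pi_map_ex (X Y : TA A) (f : hom X Y) :
  exists g : hom (pi_ob X) (pi_ob Y),
    pi_eps Y \oc fmap inclCA g = f \oc pi_eps X.
Proof.
have [k _ kK] := pi_eps_bij Y (pi_ob X).
by exists (k (f \oc pi_eps X)); apply: kK.
Qed.

Definition pi_map (X Y : TA A) (f : hom X Y) : hom (pi_ob X) (pi_ob Y) :=
  sval (cid (pi_map_ex f)).

Lemma pi_mapP (X Y : TA A) (f : hom X Y) :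
  pi_eps Y \oc fmap inclCA (pi_map f) = f \oc pi_eps X.
Proof. exact: (svalP (cid (pi_map_ex f))). Qed.

Lemma pi_map_id (X : TA A) : pi_map (idm X) = idm (pi_ob X).
Proof.
apply: (bij_inj (pi_eps_bij X (pi_ob X))).
by apply: (etrans (pi_mapP _)); rewrite comp1m; exact: (esym (compm1 _)).
Qed.

Lemma pi_map_comp (X Y Z : TA A) (g : hom Y Z) (f : hom X Y) :
  pi_map (g \oc f) = pi_map g \oc pi_map f.
Proof.
apply: (bij_inj (pi_eps_bij Z (pi_ob X))).
have Eg := pi_mapP g; have Ef := pi_mapP f; have Egf := pi_mapP (g \oc f).
apply: (etrans Egf); rewrite -compA -Ef compA -Eg -compA.
by [].
Qed.

Definition piC : functor (TA A) TC :=
  @Functor (TA A) TC pi_ob pi_map pi_map_id pi_map_comp.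

Lemma approx_data_incl (X : TC) :
  approx_data (inclCA X) =
  existT (fun XC : TC => hom (inclCA XC) (inclCA X)) X (idm (inclCA X)).
Proof.
rewrite /approx_data; case: pselect => [CX|[]]; last exact: svalP X.
by case: X CX => X CX' CX; rewrite (Prop_irrelevance CX CX').
Qed.

Lemma piC_incl : compF piC inclCA = idF.
Proof.
pose S (X : TC) := {XC : TC & hom (inclCA XC) (inclCA X)}.
pose s0 (X : TC) : S X := existT _ X (idm (inclCA X)).
pose Q (s : forall X, S X) := forall F : functor TC TC,
  forall (obE : forall X, F X = projT1 (s X)),
  (forall X Y (f : hom X Y),
     projT2 (s Y) \oc fmap inclCA (ecast Z (hom (projT1 (s X)) Z) (obE Y)
       (ecast W (hom W (F Y)) (obE X) (fmap F f))) =
     fmap inclCA f \oc projT2 (s X)) -> F = idF.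
suff : Q (fun X => approx_data (inclCA X)).
  move/(_ (compF piC inclCA) (fun=> erefl)); apply => X Y f.
  exact: pi_mapP.
have -> : (fun X => approx_data (inclCA X)) = s0.
  by apply: functional_extensionality_dep => X; exact: approx_data_incl.
case=> F Fm Fi Fc obE H.
have E : F = id by apply: functional_extensionality_dep => X; exact: obE.
subst F.
have {}H X Y f : Fm X Y f = f.
  move: (H X Y f); rewrite (Prop_irrelevance (obE X) erefl).
  rewrite (Prop_irrelevance (obE Y) erefl) => /= Hf.
  have E1 := @kcomp1m A _ _ (Fm X Y f); have E2 := @kcompm1 A _ _ f.
  by rewrite -E1 -[RHS]E2; exact: Hf.
have {H} E : Fm = fun X Y f => f.
  by apply: functional_extensionality_dep => X;
     apply: functional_extensionality_dep => Y;
     apply: functional_extensionality_dep => f; exact: H.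
subst Fm; rewrite /idF; congr Functor; exact: Prop_irrelevance.
Qed.

End Projection.

(** [0 -> R n -> ... -> R 0 -> M -> 0] is a C-resolution of [M]; [R i] is the
    term [C^{-i}] of the resolution. *)
Definition resolution (M : A) (n : nat) (R : nat -> A)
    (del : forall i, hom (R i.+1) (R i)) (eps : hom (R 0%N) M) :=
  [/\ forall i, C (R i),
      forall i, (n < i)%N -> is_zero (R i),
      [/\ is_epi eps, exact_at (del 0%N) eps
        & forall i, exact_at (del i.+1) (del i)]
    & forall Y, C Y ->
      [/\ forall g : hom Y M, exists h, g = eps \oc h,
          forall g : hom Y (R 0%N), eps \oc g = 0 <-> exists h, g = del 0%N \oc h
        & forall i (g : hom Y (R i.+1)),
            del i \oc g = 0 <-> exists h, g = del i.+1 \oc h]].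

Definition has_resolution (M : A) (n : nat) :=
  exists R del eps, @resolution M n R del eps.

(** the C-dimension of [M] is the natural number [n] *)
Definition Cdim (M : A) (n : nat) :=
  has_resolution M n /\ forall m, has_resolution M m -> (n <= m)%N.

Definition finite_Cdim := exists N, forall M, exists2 n, (n <= N)%N & Cdim M n.

End Subcategory.
End Abelian.

Arguments piC {A C} approxC.
Arguments inclCA {A} C.

(* Main.v *)
(** Call [X] C-acyclic in degree [i] when every cycle [M -> X^i] with [M] in [C]
    lifts through [X^(i-1)], i.e. when [H^i(Hom(M, X)) = 0] for all [M] in [C].
    For [X] in [K^-(C)] this decides everything: by descending construction of a
    homotopy, [X] lies in [T_C^{<=0}] iff it is C-acyclic in degrees [> 0], and in
    [T_C^{>=0}] iff it is C-acyclic in degrees [< 0].  Stalk complexes express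
    C-acyclicity as the vanishing of Hom groups in the homotopy category, so it
    passes from [tau X] to its C-approximation, which is therefore the
    truncation.  If the C-dimension is finite and [X] is C-acyclic in degrees
    [<= 0], then replacing the part of [X] in negative degrees by a finite
    C-resolution of [Ker (X^0 -> X^1)] yields a homotopy equivalent bounded
    complex; this bounds both truncations and objects of the heart. *)

From mathcomp Require Import all_boot all_order all_algebra.
From mathcomp Require Import boolp zify.
Require Import Defs.

Set Implicit Arguments.
Unset Strict Implicit.
Unset Printing Implicit Defensive.

Import Order.TTheory GRing.Theory Num.Theory.
Local Open Scope ring_scope.

(** * Isomorphisms and zero objects in preadditive categories *)

Section Isomorphisms.
Variable T : preadd.
Implicit Types X Y Z : T.

Lemma is_iso_comp X Y Z (g : hom Y Z) (f : hom X Y) :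
  is_iso g -> is_iso f -> is_iso (g \oc f).
Proof.
case=> g' [g'g gg'] [f' [f'f ff']]; exists (f' \oc g'); split.
  by rewrite -compA [g' \oc _]compA g'g comp1m.
by rewrite -compA [f \oc _]compA ff' comp1m.
Qed.

Lemma isomorphic_sym X Y : isomorphic X Y -> isomorphic Y X.
Proof. by case=> f [g [gf fg]]; exists g, f. Qed.

Lemma iso_post_bij X Y Z (c : hom Y Z) :
  is_iso c -> bijective (fun g : hom X Y => c \oc g).
Proof.
case=> c' [c'c cc']; exists (fun f => c' \oc f) => g.
  by rewrite compA c'c comp1m.
by rewrite compA cc' comp1m.
Qed.

Lemma is_zeroP X : is_zero X <-> idm X = 0.
Proof.
split=> [[H _]|X0]; first exact: H.
by split=> Y f g; [rewrite -[f]compm1 -[g]compm1 | rewrite -[f]comp1m -[g]comp1m];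
  rewrite X0 ?compm0 ?comp0m.
Qed.

End Isomorphisms.

Lemma fmap_iso (S T : preadd) (F : functor S T) X Y (f : hom X Y) :
  is_iso f -> is_iso (fmap F f).
Proof. by case=> g [gf fg]; exists (fmap F g); rewrite -!fmap_comp gf fg !fmap_id. Qed.

(** * Adjoints and equivalences from universal arrows *)

Section Adjunctions.
Variables S T : preadd.

Lemma counit_right_adjoint (F : functor S T) (G : functor T S)
    (c : forall Y, hom (F (G Y)) Y) :
  (forall Y Y' (b : hom Y Y'), c Y' \oc fmap F (fmap G b) = b \oc c Y) ->
  (forall Y X, bijective (fun g : hom X (G Y) => c Y \oc fmap F g)) ->
  right_adjoint F G.
Proof.
move=> cnat cbij.
have ex X Y (f : hom (F X) Y) : exists g : hom X (G Y), c Y \oc fmap F g = f.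
  by have [k _ kK] := cbij Y X; exists (k f).
pose phi X Y f := sval (cid (ex X Y f)).
have phiP X Y f : c Y \oc fmap F (phi X Y f) = f := svalP (cid (ex X Y f)).
have inj X Y := bij_inj (cbij Y X).
exists phi; split=> [X Y|X' X Y a f|X Y Y' b f].
- exists (fun g => c Y \oc fmap F g) => [f|g]; first exact: phiP.
  by apply: inj; rewrite phiP.
- by apply: inj; rewrite phiP fmap_comp compA phiP.
- by apply: inj; rewrite phiP fmap_comp compA cnat -compA phiP.
Qed.

(** The relation [R] lets one choice serve twice: with the universal property it yields right
    adjoints, with [is_iso] it yields quasi-inverses of fully faithful functors. *)
Lemma choose_counit (F : functor S T) (R : forall Y X, hom (F X) Y -> Prop) :
  (forall Y, exists X c, R Y X c) ->
  (forall Y X c, R Y X c ->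
     forall X', bijective (fun g : hom X' X => c \oc fmap F g)) ->
  exists (G : functor T S) (c : forall Y, hom (F (G Y)) Y),
    (forall Y, R Y (G Y) (c Y)) /\
    (forall Y Y' (b : hom Y Y'), c Y' \oc fmap F (fmap G b) = b \oc c Y).
Proof.
move=> ex univ.
pose g Y := sval (cid (ex Y)).
pose c Y : hom (F (g Y)) Y := sval (cid (svalP (cid (ex Y)))).
have cR Y : R Y (g Y) (c Y) := svalP (cid (svalP (cid (ex Y)))).
have inj X Y := bij_inj (univ _ _ _ (cR Y) X).
have mex Y Y' (b : hom Y Y') : exists a, c Y' \oc fmap F a = b \oc c Y.
  by have [k _ kK] := univ _ _ _ (cR Y') (g Y); exists (k (b \oc c Y)).
pose m Y Y' (b : hom Y Y') := sval (cid (mex Y Y' b)).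
have mP Y Y' (b : hom Y Y') : c Y' \oc fmap F (m _ _ b) = b \oc c Y :=
  svalP (cid (mex Y Y' b)).
have m1 Y : m _ _ (idm Y) = idm (g Y).
  by apply: inj; rewrite mP fmap_id comp1m compm1.
have mM X Y Z (b : hom Y Z) (a : hom X Y) : m _ _ (b \oc a) = m _ _ b \oc m _ _ a.
  by apply: inj; rewrite mP fmap_comp compA mP -!compA mP.
by exists (Functor m1 mM), c.
Qed.

Lemma right_adjoint_ex (F : functor S T) :
  (forall Y, exists X (c : hom (F X) Y),
     forall X', bijective (fun g : hom X' X => c \oc fmap F g)) ->
  exists G, right_adjoint F G.
Proof.
move=> ex; have [//|G [c [cU cnat]]] := choose_counit ex.
by exists G; apply: counit_right_adjoint cnat _ => Y X; apply: cU.
Qed.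

(** The counit consists of the chosen isomorphisms [c]; the unit at [X] comes from the preimage
    under [F] of [c (F X)]. *)
Lemma fully_faithful_equivalent (F : functor S T) :
  (forall X Y, bijective (@fmap _ _ F X Y)) ->
  (forall Y, exists X, isomorphic (F X) Y) -> equivalent S T.
Proof.
move=> ff es.
have [|G [c [cI cnat]]] := @choose_counit F (fun Y X c => is_iso c) es.
  move=> Y X c cI X'; exact: (bij_comp (iso_post_bij (F X') cI) (ff X' X)).
exists F, G; split; last by exists c.
have inj X Y := bij_inj (ff X Y).
have ex X : exists e : hom (G (F X)) X, fmap F e = c (F X).
  by have [k _ kK] := ff (G (F X)) X; exists (k (c (F X))).
exists (fun X => sval (cid (ex X))); split=> [X|X Y f].
  case: cid => e /= eE; have [c' [c'c cc']] := cI (F X).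
  have [k _ kK] := ff X (G (F X)); exists (k c').
  by split; apply: inj; rewrite fmap_comp kK eE fmap_id.
case: cid => e /= eE; case: cid => e' /= e'E.
by apply: inj; rewrite !fmap_comp eE e'E cnat.
Qed.

End Adjunctions.

(** Dependent choice in descending degrees: [Q] relates neighbouring values, and the invariant [I]
    keeps the next choice possible. *)
Lemma downward_choice (P : int -> Type) (b : int) (x0 : forall i, P i)
    (Q : forall i, P (i + 1) -> P i -> Prop) (I : forall i, P i -> Prop) :
  I b (x0 b) ->
  (forall i y, i < b -> I (i + 1) y -> exists x, Q i y x /\ I i x) ->
  exists x : forall i, P i,
    (forall i, b <= i -> x i = x0 i) /\
    (forall i, i < b -> Q i (x (i + 1)) (x i)).
Proof.
move=> I0 step.
pose ch i (y : P (i + 1)) : P i :=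
  if pselect (exists x, Q i y x /\ I i x) is left e then sval (cid e) else x0 i.
have chP i y : i < b -> I (i + 1) y -> Q i y (ch i y) /\ I i (ch i y).
  move=> ib Iy; rewrite /ch; case: pselect => [e|[]]; last exact: step.
  exact: svalP (cid e).
(* Stage [G N] is final in degrees at least [b - N], and its values below are irrelevant. Recursion
   on [N] keeps each value in its own type [P i]. *)
pose G := fix G N i : P i := if N isn't N'.+1 then x0 i else
  if b - N'%:Z <= i then G N' i else ch i (G N' (i + 1)).
have GS N i : G N.+1 i = if b - N%:Z <= i then G N i else ch i (G N (i + 1)) by [].
have Gx0 N i : b <= i -> G N i = x0 i.
  by elim: N => // N IH bi; rewrite GS IH // (le_trans _ bi) // gerBl.
have GI N i : i = b - N%:Z -> I i (G N i).
  elim: N i => [|N IH] i ->; first by rewrite subr0.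
  rewrite GS ifN; last by rewrite -ltNge; lia.
  by apply: (chP _ _ _ _).2; [lia | apply: IH; lia].
have Gstab N k i : b - N%:Z <= i -> G (N + k)%N i = G N i.
  move=> Ni; elim: k => [|k IH]; first by rewrite addn0.
  by rewrite addnS GS IH ifT //; lia.
have GE N i : b - N%:Z <= i -> G N i = G `|b - i|%N i.
  case: (lerP b i) => [bi _|ib Ni]; first by rewrite !Gx0.
  have -> : N = (`|b - i| + (N - `|b - i|))%N by lia.
  by apply: Gstab; lia.
(* Degree [i < b] is settled at stage [|b - i|]. Stages [N] and [N.+1] settle the degrees [i + 1]
   and [i]. *)
exists (fun i => G `|b - i|%N i); split=> [i /Gx0 //|i ib].
have [N NE] : exists N : nat, i + 1 = b - N%:Z by exists (absz (b - (i + 1))%R); lia.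
rewrite -(@GE N (i + 1)); last by rewrite NE.
rewrite -(@GE N.+1 i); last by lia.
rewrite GS ifN; last by rewrite -ltNge; lia.
by apply: (chP _ _ _ _).1 => //; apply: GI.
Qed.

(** * C-acyclic complexes *)

Section CAcyclic.
Variables (A : abcat) (C : A -> Prop).
Implicit Types X Y Z : complex A.

(** [j] is determined by [i]; quantifying over it avoids transports. *)
Definition cacyclic X i := forall M, C M -> forall g : hom M (X i),
  (forall k, d X i k \oc g = 0) ->
  forall j, i = j + 1 -> exists s : hom M (X j), g = d X j i \oc s.

Definition terms X := forall i, C (X i).

Lemma cacyclic_zero X i : is_zero (X i) -> cacyclic X i.
Proof. by move=> X0 M CM g _ j _; exists 0; apply: (proj2 X0). Qed.

(** For a cycle [g], write [a g = d s]. A homotopy [h] from [b a] to the identity then gives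
    [g = d (b s - h g)]. *)
Lemma cacyclic_retract X Y (a : khom X Y) (b : khom Y X) i :
  kcomp b a = cls (chid X) -> cacyclic Y i -> cacyclic X i.
Proof.
have [[{}a <-] [{}b <-]] := conj (clsP a) (clsP b).
rewrite kcompE => /cls_eqP[h Hh] Yi M CM g dg j ij.
have dag k : d Y i k \oc (a i \oc g) = 0 by rewrite compA -cmd -compA dg compm0.
have [s sE] := Yi M CM _ dag j ij.
have dgi := dg (i + 1); have := Hh i; rewrite (_ : i - 1 = j); last by lia.
move/(congr1 (fun u => u \oc g)); rewrite /= !compDl compNm comp1m.
rewrite -[b i \oc a i \oc g]compA sE -[h _ _ \oc _ \oc g]compA dgi compm0 addr0.
move/eqP; rewrite subr_eq addrC -subr_eq => /eqP <-; exists (b j \oc s - h i j \oc g).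
by rewrite compDr compmN !compA cmd.
Qed.

(** The homotopy is built from the top degree downwards: the obstruction in
    degree [i] is a cycle [Z i -> X i], which lifts as [Z i] is in [C]. *)
Lemma null_above Z X (f : chmap Z X) b (D : int -> Prop) :
  terms Z -> (forall i, b < i -> f i = 0) ->
  (forall i, D i -> D (i + 1)) -> (forall i, i <= b -> D i -> cacyclic X i) ->
  exists h : forall i j, hom (Z i) (X j), forall i, D i ->
    f i = d X (i - 1) i \oc h i (i - 1) + h (i + 1) i \oc d Z i (i + 1).
Proof.
move=> CZ fb DS acX.
pose P i := forall j, hom (Z i) (X j).
pose Q i (y : P (i + 1)) (x : P i) := D i ->
  f i = d X (i - 1) i \oc x (i - 1) + y i \oc d Z i (i + 1).
(* The invariant says that the obstruction one degree lower is again a cycle. *)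
pose I i (y : P i) := D i -> forall j k, i = j + 1 -> k = i + 1 ->
  (f i - d X j i \oc y j) \oc d Z j i = 0.
have [||h [h0 hQ]] := @downward_choice P (b + 1) (fun _ _ => 0) Q I.
- by move=> _ j k _ _; rewrite compm0 subr0 fb ?comp0m // ltrDl.
- move=> i y ib Iy; case: (pselect (D i)) => [Di|nD]; last first.
    by exists (fun=> 0); split.
  have ci : forall k, d X i k \oc (f i - y i \oc d Z i (i + 1)) = 0.
    move=> k; have [->|ki] := eqVneq k (i + 1); last by rewrite d_shape ?comp0m.
    have := Iy (DS _ Di) i _ erefl erefl; rewrite compDl compNm cmd -compA.
    by rewrite compDr compmN.
  have [||s sE] := acX i _ Di _ (CZ i) _ ci (i - 1); [lia|lia|].
  (* Only the component into degree [i - 1] matters; the others are set to zero. *)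
  exists (fun j => if pselect (i - 1 = j) is left e
                   then ecast j (hom (Z i) (X j)) e s else 0).
  have sK : (if pselect (i - 1 = i - 1) is left e
                   then ecast j (hom (Z i) (X j)) e s else 0) = s.
    by case: pselect => // e; rewrite (Prop_irrelevance e erefl).
  split=> [_|_ j k ij kE]; first by rewrite sK -sE subrK.
  rewrite (_ : j = i - 1); last by lia.
  by rewrite sK -sE subKr -compA dd compm0.
exists h => i Di; case: (lerP i b) => [ib|bi].
  by apply: hQ => //; lia.
by rewrite fb // !h0 ?compm0 ?comp0m ?addr0 //; lia.
Qed.

Lemma nullhtpy_below Z X (f : chmap Z X) b :
  terms Z -> (forall i, b < i -> f i = 0) -> (forall i, i <= b -> cacyclic X i) ->
  nullhtpy f.
Proof.
move=> CZ fb acX.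
have [//|i ib _|h hE] := @null_above Z X f b (fun=> True) CZ fb; first exact: acX.
by exists h => i; apply: hE.
Qed.

(** Below [b], the composite [f (i + 1) \oc d] is a cycle with source [Z i] in [C], so it lifts
    through [X i], and the lift is the next component. *)
Lemma extend_below Z X b (u : forall i, hom (Z i) (X i)) :
  terms Z -> (forall i, i <= b -> cacyclic X i) ->
  (forall i, b <= i -> u (i + 1) \oc d Z i (i + 1) = d X i (i + 1) \oc u i) ->
  exists f : chmap Z X, forall i, b <= i -> f i = u i.
Proof.
move=> CZ acX ud.
pose P i := hom (Z i) (X i).
pose Q i (y : P (i + 1)) (x : P i) := y \oc d Z i (i + 1) = d X i (i + 1) \oc x.
pose I i (y : P i) := forall k, d X i k \oc y \oc d Z (i - 1) i = 0.
have [||f [f0 fQ]] := @downward_choice P b u Q I.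
- move=> k; have [->|ki] := eqVneq k (b + 1); last by rewrite d_shape ?comp0m.
  by rewrite -ud // -compA dd compm0.
- move=> i y ib Iy; have [|||x xE] := acX (i + 1) _ _ (CZ i) (y \oc d Z i (i + 1)) _ i.
  + by lia.
  + by move=> k; rewrite compA; have := Iy k; rewrite (_ : i + 1 - 1 = i) //; lia.
  + by [].
  exists x; split=> // k.
  have [->|ki] := eqVneq k (i + 1); last by rewrite d_shape ?comp0m.
  by rewrite -xE -compA dd compm0.
have fE i : f (i + 1) \oc d Z i (i + 1) = d X i (i + 1) \oc f i.
  by case: (lerP b i) => ib; [rewrite !f0 ?ud //; lia | apply: fQ].
have fd i j : f j \oc d Z i j = d X i j \oc f i.
  by have [->|ij] := eqVneq j (i + 1); rewrite ?fE // !d_shape // comp0m compm0.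
by exists (Chmap fd).
Qed.

(** This is exactness at the middle term of the long exact sequence of Hom from [M]. If [v g = d t],
    then [w t] is a cycle of [X], say [w t = d t'], and [g = r v g = r d t = d (u t' + r t)]. *)
Lemma cacyclic_cone X Y Z (u : chmap X Y) (v : chmap Y Z)
    (w : chmap Z (shiftc X)) i :
  cone_triangle u v w -> cacyclic X i -> cacyclic Z i -> cacyclic Y i.
Proof.
move=> [s [r [sr rd]]] acX acZ M CM g dg j ij; subst i.
have [_ rv wv _ _] := sr (j + 1).
have [k|t tE] := acZ M CM (v (j + 1) \oc g) _ j erefl.
  by rewrite compA -cmd -compA dg compm0.
have dw k : d X (j + 1) k \oc (w j \oc t) = 0.
  have [->|kj] := eqVneq k (j + 1 + 1); last by rewrite d_shape ?comp0m.
  have := cmd w j (j + 1) => /= /(congr1 (fun a => a \oc t)).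
  rewrite -[LHS]compA -tE compA.
  have [_ _ -> _ _] := sr (j + 1); rewrite comp0m compNm compNm => /eqP.
  by rewrite eq_sym oppr_eq0 compA => /eqP.
have [t' t'E] := acX M CM _ dw j erefl.
exists (u j \oc t' + r j \oc t).
rewrite -[g]comp1m -rv -compA tE compA rd compDl -compA t'E compDr !compA.
by rewrite cmd.
Qed.

End CAcyclic.

Lemma cls_null (A : preadd) (X Y : complex A) (f : chmap X Y) :
  cls f = 0 <-> nullhtpy f.
Proof.
have E0 : cls (0 : chmap X Y) = 0.
  by apply: (@addrI _ (cls (0 : chmap X Y))); rewrite -clsD !addr0.
by rewrite -[f in nullhtpy f]subr0 -E0; apply: cls_eqP.
Qed.

(** * Stalk complexes, and C-acyclicity as vanishing of Hom *)

Section Stalks.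
Variable A : abcat.
Implicit Types X Y S : complex A.

Definition stalk_at m S := forall i, i != m -> is_zero (S i).

Lemma stalk_ex (M : A) m : exists S, S m = M /\ stalk_at m S.
Proof.
pose S := @Complex A (fun i => if i == m then M else zob A) (fun _ _ => 0)
  (fun _ _ _ => erefl) (fun _ _ _ => comp0m _ _).
exists S; rewrite /S /=; split=> [|i /=]; first by rewrite eqxx.
by move=> im; rewrite (negbTE im); apply: zobP.
Qed.

Lemma stalk_map S X m (g : hom (S m) (X m)) :
  stalk_at m S -> (forall k, d X m k \oc g = 0) ->
  exists f : chmap S X, f m = g.
Proof.
move=> S0 dg.
pose f i : hom (S i) (X i) :=
  if pselect (m = i) is left e then ecast i (hom (S i) (X i)) e g else 0.
have fm : f m = g.
  by rewrite /f; case: pselect => // e; rewrite (Prop_irrelevance e erefl).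
have fd i j : f j \oc d S i j = d X i j \oc f i.
  have [->{i}|im] := eqVneq i m; last exact: (proj1 (S0 i im)).
  rewrite fm dg; have [->|jm] := eqVneq j m; last first.
    by rewrite [f j](proj1 (S0 j jm) _ _ 0) comp0m.
  by rewrite d_shape ?compm0 //; lia.
by exists (Chmap fd).
Qed.

Variable C : A -> Prop.

(** Chain maps from the stalk of [M] in degree [i] are the cycles [M -> X i], and null homotopies
    are their lifts. The right-hand side involves only Hom groups of the homotopy category, so it
    can be carried along a C-approximation. *)
Lemma cacyclicP X i : C (zob A) -> strictly_full C ->
  cacyclic C X i <->
  forall S, terms C S -> stalk_at i S -> forall f : khom S X, f = 0.
Proof.
move=> C0 Cs; split=> [acX S CS Si f|H M CM g dg j ij].
  have [{}f <-] := clsP f; apply/cls_null.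
  (* Starting at [i] and staying in degrees at least [i], acyclicity is used in degree [i] alone;
     below [i] the source is zero. *)
  have [|||h hE] := @null_above A C S X f i (fun k => i <= k) CS.
  - move=> k ik; apply: (proj1 (Si k _)); lia.
  - by move=> k ik; lia.
  - by move=> k ki ik; rewrite (_ : k = i) //; lia.
  exists h => k; have [/hE//|ki] := lerP i k.
  by apply: (proj1 (Si k _)); lia.
have [S [SM Si]] := stalk_ex M i; subst M.
have [f fg] := stalk_map Si dg.
have CS : terms C S.
  move=> k; have [->//|/Si Sk] := eqVneq k i.
  apply: Cs C0; exists 0, 0.
  by split; [apply: (proj1 (zobP A)) | apply: (proj1 Sk)].
have /cls_null[h hE] := H S CS Si (cls f).
exists (h i j); rewrite -fg hE (_ : i - 1 = j); last by lia.
by rewrite [d S i _](proj2 (Si (i + 1) _) _ _ 0) ?compm0 ?addr0 //; lia.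
Qed.

End Stalks.

(** * The inclusion of [tau X] into [X], and when it is a homotopy equivalence *)

Section Truncation.
Variable A : abcat.
Implicit Types X Y : complex A.

Definition tau_incl_map X i : hom (tau X i) (X i) :=
  match i with
  | Negz n => idm (X (Negz n))
  | Posz 0 => kermor (d X 0 1)
  | Posz _.+1 => 0
  end.

Lemma tau_incl_proof X i j :
  tau_incl_map X j \oc d (tau X) i j = d X i j \oc tau_incl_map X i.
Proof.
case: i j => [[|i]|i] [[|j]|j] //=; rewrite ?comp0m ?compm0 ?compm1 ?comp1m ?ker_liftK //.
- by rewrite (@d_shape _ X 0 0) ?comp0m.
- case: j => [|j]; first by rewrite (proj1 (kermorP _)).
  by rewrite (@d_shape _ X 0 j.+2) ?comp0m.
- by rewrite (@d_shape _ X 0 (Negz j)) ?comp0m.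
- by rewrite d_shape //; case: i.
Qed.

Definition tau_incl X : chmap (tau X) X := Chmap (tau_incl_proof X).

Lemma tau_incl_mono X i : is_mono (tau_incl X i).
Proof.
case: i => [[|i]|i] W g h /=.
- exact: kermor_mono.
- by move=> _; apply: (proj2 (zobP A)).
- by rewrite !comp1m.
Qed.

Lemma tau_factor X Y (f : chmap Y X) : (forall i, 0 < i -> f i = 0) ->
  exists p : chmap Y (tau X), chcomp (tau_incl X) p = f.
Proof.
move=> f0.
have df : d X 0 1 \oc f 0 = 0 by rewrite -cmd f0 // comp0m.
pose p i : hom (Y i) (tau X i) :=
  match i return hom (Y i) (tau X i) with
  | Negz n => f (Negz n)
  | Posz 0 => ker_lift df
  | Posz _.+1 => 0
  end.
have jp i : tau_incl X i \oc p i = f i.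
  case: i => [[|i]|i] /=; first exact: ker_liftK; last exact: comp1m.
  by rewrite f0 // comp0m.
have pd i j : p j \oc d Y i j = d (tau X) i j \oc p i.
  by apply: (@tau_incl_mono X j); rewrite !compA jp (cmd (tau_incl X)) -compA jp cmd.
by exists (Chmap pd); apply: chmap_eq => i; apply: jp.
Qed.

(** As [f] vanishes in positive degrees, it factors as [tau_incl X] after some [p]. Then [p] is the
    inverse: one composite is [f], homotopic to the identity, the other is strictly the identity
    because the inclusion is monic. *)
Lemma tau_incl_iso X (f : chmap X X) :
  cls f = cls (chid X) -> (forall i, 0 < i -> f i = 0) ->
  chcomp f (tau_incl X) = tau_incl X ->
  @is_iso (K A) (tau X) X (cls (tau_incl X)).
Proof.
move=> f1 f0 fj; have [p jp] := tau_factor f0.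
exists (cls p); rewrite /= !kcompE jp f1; split=> //; congr cls.
apply: chmap_eq => i; apply: (@tau_incl_mono X i) => /=.
rewrite compA compm1; move/(congr1 (fun u : chmap _ _ => u i)): jp => /= ->.
exact: (congr1 (fun u : chmap _ _ => u i) fj).
Qed.

Lemma tau_incl_iso_zero X : (forall i, 0 < i -> is_zero (X i)) ->
  @is_iso (K A) (tau X) X (cls (tau_incl X)).
Proof.
move=> X0; apply: (@tau_incl_iso X (chid X)) => // [i i0|].
  exact: (proj1 (X0 i i0)).
by apply: chmap_eq => i; apply: comp1m.
Qed.

Lemma htpy_proof X Y (h : forall i j, hom (X i) (Y j)) i j :
  (d Y (j - 1) j \oc h j (j - 1) + h (j + 1) j \oc d X j (j + 1)) \oc d X i j =
  d Y i j \oc (d Y (i - 1) i \oc h i (i - 1) + h (i + 1) i \oc d X i (i + 1)).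
Proof.
have [->|ij] := eqVneq j (i + 1); last by rewrite !(d_shape _ ij) comp0m compm0.
rewrite (_ : i + 1 - 1 = i); last by lia.
by rewrite compDl compDr -!compA dd compm0 addr0 [d Y i _ \oc (d Y _ _ \oc _)]compA
  dd comp0m add0r.
Qed.

(** A contraction in positive degrees suffices: cut off to sources of positive degree, it changes
    the identity by a homotopy into a map [e] that is zero in positive degrees. In degree 0 the
    correction factors through [d X 0 1], so [e] fixes [tau X]. *)
Lemma tau_incl_iso_htpy X (h : forall i j, hom (X i) (X j)) :
  (forall i, 0 < i ->
     idm (X i) = d X (i - 1) i \oc h i (i - 1) + h (i + 1) i \oc d X i (i + 1)) ->
  @is_iso (K A) (tau X) X (cls (tau_incl X)).
Proof.
move=> hE; pose h' i j := if 0 < i then h i j else 0.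
pose e := chid X - Chmap (htpy_proof h').
apply: (@tau_incl_iso X e) => [|i i0|].
- apply/cls_eqP; exists (fun i j => - h' i j) => i.
  by rewrite compNm compmN -opprD /= addrAC subrr add0r.
- by rewrite /e /= /h' i0 ifT -?hE ?subrr //; lia.
apply: chmap_eq => -[[|i]|i] /=; first 1 last.
- exact: compm0.
- by rewrite /h' !ifN ?compm0 ?comp0m ?addr0 ?subr0 ?comp1m // -leNgt; lia.
by rewrite compDl compNm compDl -!compA (proj1 (kermorP _)) !compm0 addr0 comp1m
  /h' ltxx comp0m compm0 subr0.
Qed.

Definition tauT (X : TA A) : hom (tauA A X) X := cls (tau_incl (sval X)).

Lemma tauT_nat (X Y : TA A) (f : hom X Y) :
  tauT Y \oc fmap (tauA A) f = f \oc tauT X.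
Proof.
have [{}f <-] := clsP f.
rewrite /tauT /= (ktau_mapE f) !kcompE; congr cls.
apply: chmap_eq => -[[|i]|i] /=; rewrite ?comp0m ?compm0 ?comp1m ?compm1 //.
exact: ker_liftK.
Qed.

Lemma tauT_tau (X : TA A) : fmap (tauA A) (tauT X) = tauT (tauA A X).
Proof.
rewrite /tauT /= (ktau_mapE (tau_incl (sval X))); congr cls.
apply: chmap_eq => -[[|i]|i] //=; by apply: kermor_mono; rewrite ker_liftK.
Qed.

Lemma tauT_iso (Y : TA A) : TleA Y -> is_iso (tauT Y).
Proof.
case=> Y0 [a aI] Y00; have [a' [a'a aa']] := aI.
have -> : tauT Y = a' \oc (tauT Y0 \oc fmap (tauA A) a).
  by rewrite tauT_nat compA a'a comp1m.
apply: is_iso_comp; first by exists a.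
by apply: is_iso_comp (fmap_iso _ aI); apply: tau_incl_iso_zero.
Qed.

End Truncation.

(** * The t-structure on T_C *)

Lemma comp_squares (T : preadd) (X2 X1 X Y2 Y1 Y : T) (p : hom X2 X1) (t : hom X1 X)
    (p' : hom Y2 Y1) (t' : hom Y1 Y) (f2 : hom X2 Y2) (f1 : hom X1 Y1) (f : hom X Y) :
  p' \oc f2 = f1 \oc p -> t' \oc f1 = f \oc t ->
  (t' \oc p') \oc f2 = f \oc (t \oc p).
Proof. by move=> E1 E2; rewrite -compA E1 compA E2 compA. Qed.

(** The inverse sends [f] to its truncation composed with the inverse of [tauT Y]; idempotence of
    truncation, [tauT_tau], is what makes this work. *)
Lemma tauT_univ (A : abcat) (X Y : TA A) :
  TleA Y -> bijective (fun g : hom Y (tauA A X) => tauT X \oc g).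
Proof.
move=> /tauT_iso[k [kj jk]]; exists (fun f => fmap (tauA A) f \oc k) => g.
  by rewrite fmap_comp tauT_tau tauT_nat -compA jk compm1.
by rewrite compA tauT_nat -compA jk compm1.
Qed.

(** * Restricting an aisle to a full subcategory and comparing hearts *)

Section SubTriangulated.
Variables (T : tricat) (P Q : T -> Prop).
Hypothesis PS : forall X, P X -> P (shift X).

Definition ext_closed (U : tricat) (R : U -> Prop) :=
  forall X Y Z (f : hom X Y) (g : hom Y Z) (h : hom Z (shift X)),
    dist f g h -> R X -> R Z -> R Y.

Lemma ext_closed_sub : ext_closed Q -> @ext_closed (subtri PS) (fun X => Q (sval X)).
Proof. by move=> H X Y Z f g h fgh; apply: H fgh. Qed.

Hypothesis Q_iso : forall X Y, isomorphic X Y -> Q X -> Q Y.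
Hypothesis coaisleP : forall X,
  (forall Y, P Y -> Q Y -> forall f : hom (shift Y) X, f = 0) -> coaisle Q X.

Local Notation QP := (fun X : subtri PS => Q (sval X)).

Lemma coaisle_sub (X : subtri PS) : coaisle QP X -> coaisle Q (sval X).
Proof. by move=> H; apply: coaisleP => Y PY; apply: (H (exist _ Y PY)). Qed.

(** Orthogonality inside the subcategory is tested only on objects of [P]; [coaisleP] makes this
    enough. *)
Definition heart_incl : functor (heart QP) (heart Q) :=
  @Functor (heart QP) (heart Q)
    (fun X => exist _ (sval (sval X))
       (conj (svalP X).1 (coaisle_sub (svalP X).2)))
    (fun X Y f => f) (fun=> erefl) (fun X Y Z g f => erefl).

Lemma heart_sub_equivalent :
  (forall X, Q X -> coaisle Q X -> exists W : subtri PS, isomorphic (sval W) X) ->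
  equivalent (heart QP) (heart Q).
Proof.
move=> ex; apply: (fully_faithful_equivalent (F := heart_incl)) => [X Y|[X [QX co]]].
  by exists id.
have [W [f [g [gf fg]]]] := ex X QX co.
have QW : Q (sval W) by apply: Q_iso QX; exists g, f.
have coW : coaisle QP W.
  move=> Y QY u; have E : f \oc u = 0 :> hom (shift (sval Y)) X by apply: co.
  by rewrite -[LHS](@comp1m T) -gf -compA E; apply: (@compm0 T).
by exists (exist _ W (conj QW coW)), f, g.
Qed.

End SubTriangulated.

(** * Aisle, coaisle and truncation on K^-(C) *)

Section Aisle.
Variables (A : abcat) (C : A -> Prop).
Hypothesis C_additive : is_additive (fullsub C).
Hypothesis C_strict : strictly_full C.

Lemma C_zob : C (zob A).
Proof.
case: C_additive => -[[Z CZ] [Z0 _]] _.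
have {}Z0 : is_zero Z by apply/is_zeroP; exact: Z0 (exist _ Z CZ) _ _.
apply: C_strict CZ; exists 0, 0.
by split; [apply: (proj1 Z0) | apply: (proj1 (zobP A))].
Qed.

Local Notation cpx X := (sval (sval X)).

Definition TC_of X (aX : bounded_above (X : K A)) (CX : terms C X) : TC C :=
  exist (@terms_in A C) (exist _ (X : K A) aX) CX.

Lemma stalk_bounded S m :
  stalk_at m S -> bounded_above S /\ bounded_below (S : complex A).
Proof. by move=> Sm; split; exists m => i mi; apply: Sm; lia. Qed.

(** Complexes vanishing in positive degrees are C-acyclic there, and retracts inherit this.
    Conversely, [null_above] applied to the identity of [X], starting from the upper bound [n],
    contracts [X] in positive degrees, so [tau X] is isomorphic to [X]. *)
Lemma TleC_cacyclic (X : TC C) :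
  TleC X <-> forall i, 0 < i -> cacyclic C (cpx X) i.
Proof.
split=> [[Y [f [g [gf fg]]] Y0] i i0|acX].
  by apply: (@cacyclic_retract A C _ _ f g i gf); apply/cacyclic_zero/Y0.
case: X acX => -[X [n Xn]] CX /= acX.
have [i ni|i i0|i _ /acX//|h hE] :=
    @null_above A C X X (chid X) n (fun i => 0 < i) CX.
- exact: (proj1 (Xn i ni)).
- by lia.
exists (tauA A (exist _ X (ex_intro _ n Xn))); last by case=> [[|i]|i] //= _; apply: zobP.
apply: isomorphic_sym; exists (tauT _); exact: (tau_incl_iso_htpy hE).
Qed.

Lemma cacyclic_iso (X Y : TC C) i :
  isomorphic X Y -> cacyclic C (cpx X) i -> cacyclic C (cpx Y) i.
Proof. by case=> f [g [_ fg]]; exact: (@cacyclic_retract A C _ _ g f i fg). Qed.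

Lemma TleC_iso (X Y : TC C) : isomorphic X Y -> TleC X -> TleC Y.
Proof.
move=> XY /TleC_cacyclic acX; apply/TleC_cacyclic => i i0.
exact: cacyclic_iso XY (acX i i0).
Qed.

Lemma TleC_shift (X : TC C) : TleC X -> TleC (shift X).
Proof.
case=> Y [f fI] Y0; exists (shift Y) => [|i i0]; last by apply: Y0; lia.
by exists (fmap shift f); apply: fmap_iso.
Qed.

Lemma cacyclic_ext i : @ext_closed (K A) (fun X => cacyclic C X i).
Proof.
move=> X Y Z f g h [X' [Y' [Z' [u [v [w [a [b [c]]]]]]]]].
case=> uvw [[a' [_ aa']] [b' [b'b _]] [c' [_ cc']]] _ _ _ acX acZ.
apply: (cacyclic_retract b'b); apply: (cacyclic_cone uvw).
  exact: (cacyclic_retract aa' acX).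
exact: (cacyclic_retract cc' acZ).
Qed.

Lemma TleC_ext : ext_closed (@TleC A C).
Proof.
move=> X Y Z f g h fgh /TleC_cacyclic acX /TleC_cacyclic acZ.
apply/TleC_cacyclic => i i0.
have H : @ext_closed (TC C) (fun X => cacyclic C (cpx X) i).
  exact (@ext_closed_sub (TA A) _ (fun X => cacyclic C (sval X) i) _
    (@ext_closed_sub (K A) _ (fun X => cacyclic C X i) _ (@cacyclic_ext i))).
exact: (H _ _ _ f g h fgh (acX i i0) (acZ i i0)).
Qed.

(** The terms of [Y0] may lie outside [C], so the homotopy is built on [Y]: [f] is replaced by its
    composite [e] with the shift of [b a], which vanishes in degrees above -1. *)
Lemma cacyclic_shift_hom0 (X Y Y0 : complex A) (a : khom Y Y0) (b : khom Y0 Y)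
    (f : khom (shiftc Y) X) :
  terms C Y -> kcomp b a = cls (chid Y) -> (forall i, 0 < i -> is_zero (Y0 i)) ->
  (forall i, i < 0 -> cacyclic C X i) -> f = 0.
Proof.
have [[{}f <-] [{}a <-] [{}b <-]] := And3 (clsP f) (clsP a) (clsP b).
move=> CY ba Y00 acX; pose e := chcomp f (shiftm (chcomp b a)).
have -> : cls f = cls e.
  rewrite -kcompE -kshift_mapE -kcompE ba kshift_mapE kcompE.
  by congr cls; apply: chmap_eq => i; rewrite /= compm1.
apply/cls_null; apply: (@nullhtpy_below A C _ _ e (-1)) => [i|i i0|i i0].
- exact: CY.
- by rewrite /= [a (i + 1)](proj2 (Y00 (i + 1) _) _ _ 0) ?compm0 //; lia.
- by apply: acX; lia.
Qed.

Lemma cacyclic_coaisle (X : TC C) :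
  (forall i, i < 0 -> cacyclic C (cpx X) i) -> coaisle (@TleC A C) X.
Proof.
move=> acX Y [Y0 [a [b [ba _]]] Y00] f.
exact: (@cacyclic_shift_hom0 _ _ _ a b f (svalP Y) ba Y00 acX).
Qed.

(** A cycle in degree [i < 0] is a map from the shift of a stalk in degree [i + 1 <= 0], which is a
    bounded object of the aisle. Testing on bounded [Y] only makes the lemma apply to K^-(C) and
    K^b(C) alike. *)
Lemma coaisle_cacyclic (X : TC C) :
  (forall Y : TC C, bounded Y -> TleC Y -> forall f : hom (shift Y) X, f = 0) ->
  forall i, i < 0 -> cacyclic C (cpx X) i.
Proof.
move=> H i i0 M CM g dg j ij.
have [S [SM Si]] := stalk_ex M (i + 1); subst M.
have CS : terms C S.
  move=> k; have [->//|/Si Sk] := eqVneq k (i + 1).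
  apply: C_strict C_zob; exists 0, 0.
  by split; [apply: (proj1 (zobP A)) | apply: (proj1 Sk)].
have sSi : stalk_at i (shiftc S) by move=> k ki; apply: Si; lia.
have [f fg] := stalk_map (S := shiftc S) sSi dg.
have [aS bS] := stalk_bounded Si.
have /cls_null[h hE] : cls f = 0.
  apply: (H (TC_of aS CS)) => //; apply/TleC_cacyclic => k k0 /=.
  by apply: cacyclic_zero; apply: Si; lia.
exists (h i j); rewrite -fg hE (_ : i - 1 = j); last by lia.
by rewrite [d (shiftc S) i _](proj2 (sSi (i + 1) _) _ _ 0) ?compm0 ?addr0 //; lia.
Qed.

Hypothesis approxC : approximating C.

(** Maps from a stalk in [C] to the approximation inject into maps to [X], which vanish. *)
Lemma cacyclic_pi (X : TA A) i :
  cacyclic C (sval X) i -> cacyclic C (cpx (piC approxC X)) i.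
Proof.
move=> acX; apply/(cacyclicP _ _ C_zob C_strict) => S CS Si f.
pose S' := TC_of (stalk_bounded Si).1 CS.
apply: (bij_inj (pi_eps_bij approxC X S')); rewrite [RHS]compm0.
exact: (proj1 (cacyclicP _ _ C_zob C_strict) acX S CS Si).
Qed.

Lemma TleC_pi_tau (X : TA A) : TleC (piC approxC (tauA A X)).
Proof.
apply/TleC_cacyclic => i i0; apply: cacyclic_pi; apply: cacyclic_zero.
by case: i i0 => [[|i]|i] //= _; apply: zobP.
Qed.

Definition tauC := compF (piC approxC) (compF (tauA A) (inclCA C)).

Definition tauC_counit (X : TC C) : hom (tauC X) X :=
  tauT (inclCA C X) \oc pi_eps approxC (tauA A (inclCA C X)).

Lemma tauC_counit_nat (X Y : TC C) (f : hom X Y) :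
  tauC_counit Y \oc fmap tauC f = f \oc tauC_counit X.
Proof.
have E1 := pi_mapP approxC (fmap (tauA A) (fmap (inclCA C) f)).
have E2 := tauT_nat (fmap (inclCA C) f).
exact: (@comp_squares (TA A) _ _ _ _ _ _ _ _ _ _ _ _ _ E1 E2).
Qed.

(** The universal properties of [tauT] and of the C-approximation compose. *)
Lemma tauC_counit_univ (X Y : TC C) : TleC Y ->
  bijective (fun g : hom Y (tauC X) => tauC_counit X \oc g).
Proof.
move=> Yle.
have b1 := tauT_univ (inclCA C X) Yle.
have b2 := pi_eps_bij approxC (tauA A (inclCA C X)) Y.
apply: (eq_bij (bij_comp b1 b2)) => g.
exact: (@compA (TA A) (inclCA C Y) _ _ _ (tauT _) (pi_eps approxC _) g).
Qed.

Lemma TleC_truncation : is_truncation (@TleC A C) tauC.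
Proof.
exists (fun X => TleC_pi_tau (inclCA C X)).
refine (@counit_right_adjoint _ _ (incl (@TleC A C)) (corestr _) tauC_counit _ _).
  exact tauC_counit_nat.
by move=> X [Y Yle]; exact (tauC_counit_univ X Yle).
Qed.

Lemma TleC_t_structure : t_structure (@TleC A C).
Proof.
split; [exact: TleC_shift | exact: TleC_ext | ].
by have [FP adj] := TleC_truncation; exists (corestr FP).
Qed.

End Aisle.

(** * Bounded complexes *)

Section ShiftBy.
Variable A : preadd.
Implicit Types X Y : complex A.

Lemma shiftby_shape X n i j : j != i + 1 -> d X (i + n) (j + n) = 0.
Proof. by move=> ij; rewrite d_shape //; apply: contra_neq ij; lia. Qed.

(** Unlike [shiftc], no sign is introduced: this only moves a given degree to 0 and back. *)
Definition shiftby n X : complex A :=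
  @Complex A (fun i => X (i + n)) (fun i j => d X (i + n) (j + n))
    (@shiftby_shape X n) (fun i j k => dd X _ _ _).

Lemma shiftbyK n X : shiftby (- n) (shiftby n X) = X.
Proof.
(* Generalising the reindexing to a variable [s] lets it be replaced by the identity without
   casts. *)
suff H (s : int -> int) p q : (forall i, s i = i) ->
    @Complex A (fun i => X (s i)) (fun i j => d X (s i) (s j)) p q = X.
  by apply: (H (fun i => i - n + n)) => i; apply: subrK.
move=> sE; have E : s = id by apply: functional_extensionality_dep.
by subst s; case: X p q => X dX p q p' q'; congr Complex; apply: Prop_irrelevance.
Qed.

Lemma isomorphic_shiftby n X Y :
  @isomorphic (K A) X Y -> @isomorphic (K A) (shiftby n X) (shiftby n Y).
Proof.
pose sh X Y (f : chmap X Y) : chmap (shiftby n X) (shiftby n Y) :=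
  @Chmap _ (shiftby n X) (shiftby n Y) (fun i => f (i + n)) (fun i j => cmd f _ _).
have sh1 Z (f : chmap Z Z) :
    cls f = cls (chid Z) -> cls (sh _ _ f) = cls (chid (shiftby n Z)).
  move/cls_eqP=> [h hE]; apply/cls_eqP.
  exists (fun i j => h (i + n) (j + n)) => i; have := hE (i + n) => /= ->.
  by rewrite (addrAC i n (-1)) (addrAC i n 1).
case=> f [g []]; have [[{}f <-] [{}g <-]] := conj (clsP f) (clsP g).
rewrite /= !kcompE => /sh1 gf /sh1 fg.
exists (cls (sh _ _ f)), (cls (sh _ _ g)); rewrite /= !kcompE.
split; [apply: etrans gf | apply: etrans fg]; congr cls; exact: chmap_eq.
Qed.

End ShiftBy.

Lemma cacyclic_shiftby (A : abcat) (C : A -> Prop) (X : complex A) n i :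
  cacyclic C X (i + n) -> cacyclic C (shiftby n X) i.
Proof.
move=> acX M CM g dg j ij; apply: acX => // [k|]; last by lia.
by have := dg (k - n); rewrite /= subrK.
Qed.

Lemma PoszS (i : nat) : Posz i + 1 = Posz i.+1. Proof. lia. Qed.
Lemma NegzS (i : nat) : Negz i.+1 + 1 = Negz i. Proof. lia. Qed.
Lemma NegzS0 : Negz 0 + 1 = Posz 0. Proof. lia. Qed.

(** * Replacing the negative part of a complex by a finite resolution *)

Section Glue.
Variables (A : abcat) (C : A -> Prop) (T : complex A).
Variables (n : nat) (R : nat -> A) (del : forall i, hom (R i.+1) (R i)).
Variable eps : hom (R 0%N) (kerob (d T 0 1)).
Hypothesis res : resolution C n del eps.

(** [... -> R 1 -> R 0 -> T^0 -> T^1 -> ...], where [R 0] has degree [-1]. *)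
Definition glue_ob (i : int) : A :=
  match i with Posz m => T m | Negz a => R a end.

Definition glue_del a b : hom (R a) (R b) :=
  if pselect (b.+1 = a) is left e then ecast a (hom (R a) (R b)) e (del b) else 0.

Definition glue_d (i j : int) : hom (glue_ob i) (glue_ob j) :=
  match i, j return hom (glue_ob i) (glue_ob j) with
  | Posz k, Posz l => d T k l
  | Negz a, Negz b => glue_del a b
  | Negz 0, Posz 0 => kermor (d T 0 1) \oc eps
  | _, _ => 0
  end.

Lemma glue_delS a : glue_del a.+1 a = del a.
Proof. by rewrite /glue_del; case: pselect => // e; rewrite (Prop_irrelevance e erefl). Qed.

Lemma glue_del0 a b : b.+1 <> a -> glue_del a b = 0.
Proof. by rewrite /glue_del; case: pselect. Qed.

Lemma glue_shape i j : j != i + 1 -> glue_d i j = 0.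
Proof.
case: i j => [i|[|i]] [[|j]|j] //= ij; rewrite ?d_shape ?glue_del0 //.
by move=> e; move/eqP: ij; apply; lia.
Qed.

(** The terms of the resolution lie in [C], so Hom-exactness can be tested on their identities. *)
Lemma resolution_dd : eps \oc del 0%N = 0 /\ forall i, del i \oc del i.+1 = 0.
Proof.
case: res => CR _ _ ex; split=> [|i].
  have [_ H _] := ex _ (CR 1%N); apply/H; exists (idm _); by rewrite compm1.
have [_ _ H] := ex _ (CR i.+2); apply/H; exists (idm _); by rewrite compm1.
Qed.

Lemma glue_dd i j k : glue_d j k \oc glue_d i j = 0.
Proof.
have [ed dd0] := resolution_dd.
have [->|jk] := eqVneq k (j + 1); last by rewrite glue_shape // comp0m.
have [->|ij] := eqVneq j (i + 1); last by rewrite (glue_shape ij) compm0.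
case: i => [i|[|[|i]]].
- by rewrite !PoszS /= dd.
- by rewrite NegzS0 PoszS /= compA (proj1 (kermorP _)) comp0m.
- by rewrite NegzS NegzS0 /= glue_delS -compA ed compm0.
by rewrite !NegzS /= !glue_delS.
Qed.

Definition glue : complex A := Complex glue_shape glue_dd.

(** In degree 0 a cycle factors through the kernel and lifts along [eps]; in lower degrees this is
    exactness of Hom from [M] into the resolution. *)
Lemma cacyclic_glue i : i <= 0 -> cacyclic C glue i.
Proof.
have [CR _ _ ex] := res.
case: i => [[|i]|[|i]] // _ M CM g dg j ij; have [ex0 ex1 exS] := ex M CM.
- have -> : j = Negz 0 by lia.
  have [h hE] := ex0 (ker_lift (dg 1)).
  by exists h; rewrite /= -compA -hE ker_liftK.
- have -> : j = Negz 1 by lia.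
  have [h ->] : exists h, g = del 0%N \oc h.
    by apply/ex1/kermor_mono; rewrite compA compm0; apply: dg 0.
  by exists h; rewrite /= glue_delS.
have -> : j = Negz i.+2 by lia.
have [h ->] : exists h, g = del i.+1 \oc h.
  by apply/exS; have := dg (Negz i); rewrite /= glue_delS.
by exists h; rewrite /= glue_delS.
Qed.

Lemma terms_glue : terms C T -> terms C glue.
Proof. by move=> CT [i|i] /=; [apply: CT | have [CR _ _ _] := res; apply: CR]. Qed.

Lemma glue_bounded_above : bounded_above T -> bounded_above glue.
Proof.
by case=> m Tm; exists `|m| => -[i|i] im; [apply: Tm | ]; lia.
Qed.

Lemma glue_bounded_below : bounded_below glue.
Proof.
have [_ R0 _ _] := res.
by exists (Negz n) => -[i|i] ini; [lia | apply: R0; lia].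
Qed.

(** The complexes agree in degrees at least 0, and acyclicity extends the identity there to chain
    maps both ways. The composites differ from identities only in degrees at most -1, where
    acyclicity again supplies null homotopies. *)
Lemma isomorphic_glue : terms C T -> (forall i, i <= 0 -> cacyclic C T i) ->
  @isomorphic (K A) T glue.
Proof.
move=> CT acT; have CG := terms_glue CT.
pose u i : hom (T i) (glue i) :=
  match i return hom (T i) (glue i) with Posz m => idm (T m) | Negz _ => 0 end.
pose v i : hom (glue i) (T i) :=
  match i return hom (glue i) (T i) with Posz m => idm (T m) | Negz _ => 0 end.
have uv i : 0 <= i -> u i \oc v i = idm (glue i) by case: i => //= i _; rewrite comp1m.
have vu i : 0 <= i -> v i \oc u i = idm (T i) by case: i => //= i _; rewrite comp1m.
have [[i|//] i0|f fu] := extend_below (b := 0) (u := u) CT cacyclic_glue.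
  by rewrite PoszS /= comp1m compm1.
have [[i|//] i0|g gv] := extend_below (b := 0) (u := v) CG acT.
  by rewrite PoszS /= comp1m compm1.
exists (cls f), (cls g); rewrite /= !kcompE; split; apply/cls_eqP.
  apply: (@nullhtpy_below A C _ _ _ (-1)) CT _ _ => [i i0|i i0].
    by rewrite /= fu ?gv ?vu ?subrr //; lia.
  by apply: acT; lia.
apply: (@nullhtpy_below A C _ _ _ (-1)) CG _ _ => [i i0|i i0].
  by rewrite /= fu ?gv ?uv ?subrr //; lia.
by apply: cacyclic_glue; lia.
Qed.

End Glue.

(** * The t-structure on K^b(C) and its heart *)

Section Bounded.
Variables (A : abcat) (C : A -> Prop).
Hypothesis C_additive : is_additive (fullsub C).
Hypothesis C_strict : strictly_full C.
Hypothesis C_finite : finite_Cdim C.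

Local Notation cpx X := (sval (sval X)).

(** Shift degree [m] to 0, glue in a finite C-resolution of the kernel there, and shift back. *)
Lemma bounded_model (T : TC C) m :
  (forall i, i <= m -> cacyclic C (cpx T) i) ->
  exists W : TbC C, isomorphic (sval W) T.
Proof.
case: T => -[T [N TN]] CT /= acT; pose T' := shiftby m T.
have [D HD] := C_finite; have [n _ [[R [del [eps res]]] _]] := HD (kerob (d T' 0 1)).
have CT' : terms C T' by move=> i; apply: CT.
have aT' : bounded_above T' by exists (N - m) => i iN; apply: (TN _ _); lia.
have acT' i : i <= 0 -> cacyclic C T' i.
  by move=> i0; apply: cacyclic_shiftby; apply: acT; lia.
have iso := isomorphic_glue res CT' acT'.
have := isomorphic_shiftby (- m) iso; rewrite shiftbyK.
set W := shiftby _ _ => TW.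
have CW : terms C W by move=> i; apply: (terms_glue res CT').
have aW : bounded_above W.
  by have [k Wk] := glue_bounded_above res aT'; exists (k + m) => i ik; apply: Wk; lia.
have bW : bounded_below W.
  by have [k Wk] := glue_bounded_below res; exists (k + m) => i ik; apply: Wk; lia.
exists (exist (@bounded A C) (TC_of aW CW) (conj aW bW)).
exact: isomorphic_sym TW.
Qed.

Hypothesis approxC : approximating C.

Lemma cacyclic_tau_below (X : complex A) : bounded_below X ->
  exists m, forall i, i <= m -> cacyclic C (tau X) i.
Proof.
(* In negative degrees [tau X] has the terms of [X], which vanish below [m]. *)
case=> m Xm; exists (Num.min (m - 1) (-1)) => i im; apply: cacyclic_zero.
by case: i im => [i|i] im; [lia | apply: Xm; lia].
Qed.

(** The truncation in K^-(C) of a bounded complex is C-acyclic in low degrees, so it has a bounded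
    model [W]; the counit is transported along that isomorphism. *)
Lemma TbleC_truncation_ex (X : TbC C) :
  exists (W : fullsub (@TbleC A C)) (c : hom (incl _ W) X),
    forall Y, bijective (fun g : hom Y W => c \oc fmap (incl (@TbleC A C)) g).
Proof.
case: X => X [aX bX]; have [m acm] := cacyclic_tau_below bX.
have [|W [f fI]] := @bounded_model (tauC approxC X) m.
  by move=> i im; apply: cacyclic_pi => //; apply: acm.
have Wle : TleC (sval W).
  by apply: TleC_iso (TleC_pi_tau C_additive C_strict approxC (inclCA C X));
    apply: isomorphic_sym; exists f.
exists (exist _ W Wle), (tauC_counit approxC X \oc f) => -[Y Yle].
have b1 := tauC_counit_univ approxC X Yle.
have b2 := iso_post_bij (sval Y) fI.
exact (eq_bij (bij_comp b1 b2) (fun g => @compA (TC C) (sval Y) (sval W)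
  (tauC approxC X) X (tauC_counit approxC X) f g)).
Qed.

Lemma TbleC_t_structure : t_structure (@TbleC A C).
Proof.
split; first by move=> X; exact (@TleC_shift A C (sval X)).
  exact (@ext_closed_sub (TC C) _ (@TleC A C) _ (@TleC_ext A C)).
exact (right_adjoint_ex TbleC_truncation_ex).
Qed.

Lemma heart_equivalent : equivalent (heart (@TbleC A C)) (heart (@TleC A C)).
Proof.
refine (@heart_sub_equivalent (TC C) (@bounded A C) (@TleC A C) _ _ _ _).
- exact (@TleC_iso A C).
- move=> X H; apply: cacyclic_coaisle; exact: coaisle_cacyclic.
(* Objects of the heart are C-acyclic in degrees at most -1, hence have bounded models. *)
move=> X Xle co; apply: (@bounded_model X (-1)) => i i0.
have {}i0 : i < 0 by lia.
by apply: coaisle_cacyclic i0 => // Y _; apply: co.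
Qed.

End Bounded.

Theorem proposition3p10 (A : abcat) (C : A -> Prop)
    (C_additive : is_additive (fullsub C))
    (C_strict : strictly_full C)
    (C_karoubi : karoubi_closed C)
    (approxC : approximating C) :
  (t_structure (TleC (C := C)) /\
   is_truncation (TleC (C := C))
     (compF (piC approxC) (compF (tauA A) (inclCA C))))
  /\
  (finite_Cdim C ->
   t_structure (TbleC (C := C)) /\
   equivalent (heart (TbleC (C := C))) (heart (TleC (C := C)))).
Proof.
split; first by split; [apply: TleC_t_structure | apply: TleC_truncation].
by move=> fin; split; [apply: TbleC_t_structure | apply: heart_equivalent].
Qed.
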